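(* Let $(G,K)$ be a compact Gelfand pair, let $L$ be a locally compact group with neutral element $e_L$, and let $f:G\times L\to\mathbb{C}$ be a continuous function. Then $f$ belongs to $\mathcal P_K^\sharp(G,L)$ if and only if there exists a function $B:Z\to\mathcal P(L)$ (i.e. a family $(B(\varphi))_{\varphi\in Z}$ of continuous positive definite functions on $L$) satisfying $\sum_{\varphi\in Z}B(\varphi)(e_L)<\infty$ such that $$f(x,u)=\sum_{\varphi\in Z}B(\varphi)(u)\varphi(x),\qquad x\in G,\ u\in L.$$ This expansion is uniformly convergent for $(x,u)\in G\times L$, and $$B(\varphi)(u)=\delta(\varphi)\int_G f(x,u)\overline{\varphi(x)}\,d\omega_G(x),\qquad u\in L.$$
   Context: For a locally compact group $H$, a continuous function $g:H\to\mathbb{C}$ is positive definite if for all $n\in\mathbb{N}$, $x_1,\dots,x_n\in H$, $c_1,\dots,c_n\in\mathbb{C}$ one has $\sum_{j,k}g(x_j^{-1}x_k)c_j\overline{c_k}\ge0$; the set of such functions is $\mathcal P(H)$. Let $G$ be a locally compact group and $K$ a compact subgroup; a function $g$ on $G$ is bi-invariant with respect to $K$ if $g(kxl)=g(x)$ for all $x\in G$, $k,l\in K$. $(G,K)$ is a Gelfand pair if the algebra of continuous compactly supported bi-$K$-invariant functions on $G$ is commutative under convolution $f*g(x)=\int_G f(y)g(y^{-1}x)\,d\omega_G(y)$; it is a compact Gelfand pair if moreover $G$ is compact. $\omega_G$ denotes Haar measure on $G$ normalized to $\omega_G(G)=1$, and $\omega_K$ normalized Haar measure on $K$. A spherical function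 for $(G,K)$ is a continuous $\varphi:G\to\mathbb{C}$ with $\int_K\varphi(xky)\,d\omega_K(k)=\varphi(x)\varphi(y)$ for all $x,y\in G$ and $\varphi(e_G)=1$. $Z$ denotes the set of positive definite spherical functions. For $\varphi\in Z$, $\delta(\varphi)$ is the (finite) dimension of the linear span of the functions $x\mapsto\varphi(g^{-1}x)$, $g\in G$. $\mathcal P_K^\sharp(G,L)$ denotes the set of continuous positive definite functions $f$ on the product group $G\times L$ which are bi-invariant with respect to $K$ in the first variable, i.e. $f(kxl,u)=f(x,u)$ for $k,l\in K$, $x\in G$, $u\in L$. *)

(* Defs.v *)
(* Complex numbers are R[i] (real_closed
   `complex`) over an abstract realType R, with the norm topology of R[i]
   (accessed through the alias (R[i])^o). *)
From mathcomp Require Import all_boot all_order all_algebra.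
From mathcomp Require Import all_classical all_reals all_analysis.
From mathcomp Require Import complex.
Import Order.TTheory GRing.Theory Num.Theory numFieldNormedType.Exports.

Set Implicit Arguments.
Unset Strict Implicit.
Unset Printing Implicit Defensive.

Local Open Scope ring_scope.
Local Open Scope classical_set_scope.

Section Defs.
Variable R : realType.
Local Notation C := (R[i]).

Definition contC {T : topologicalType} (f : T -> C) : Prop :=
  continuous (f : T -> (R[i])^o).

Definition is_group {T : Type} (mul : T -> T -> T) (inv : T -> T) (e : T) :=
  [/\ forall x y z, mul x (mul y z) = mul (mul x y) z,
      forall x, mul e x = x,
      forall x, mul x e = x,
      forall x, mul (inv x) x = e &
      forall x, mul x (inv x) = e].

Definition is_topgroup {T : topologicalType} (mul : T -> T -> T) (inv : T -> T)
  (e : T) :=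
  [/\ is_group mul inv e,
      continuous (fun p : T * T => mul p.1 p.2) &
      continuous inv].

Definition is_lc_group {T : topologicalType} (mul : T -> T -> T) (inv : T -> T)
  (e : T) :=
  [/\ is_topgroup mul inv e, hausdorff_space T &
      forall x : T, exists A : set T, compact A /\ nbhs x A].

Definition is_compact_group {T : topologicalType} (mul : T -> T -> T)
  (inv : T -> T) (e : T) :=
  [/\ is_topgroup mul inv e, hausdorff_space T & compact [set: T]].

Definition is_subgroup {T : Type} (mul : T -> T -> T) (inv : T -> T) (e : T)
  (K : set T) :=
  [/\ K e, forall x y, K x -> K y -> K (mul x y) & forall x, K x -> K (inv x)].

(* ---------- normalized Haar integral of a compact subgroup H of G ----------
   I is the normalized Haar integral of H, seen as a functional on continuous
   complex functions on the (compact Hausdorff) group G; by Tietze these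
   restrict to all continuous functions on H, and by Riesz/uniqueness of Haar
   measure such an I is exactly f |-> \int_H f d omega_H. *)
Definition is_haar_integral {T : topologicalType} (mul : T -> T -> T)
  (H : set T) (I : (T -> C) -> C) :=
  [/\ forall f g, contC f -> contC g -> I (fun x => f x + g x) = I f + I g,
      forall (c : C) f, contC f -> I (fun x => c * f x) = c * I f,
      forall f, contC f -> (forall x, H x -> 0 <= f x) -> 0 <= I f,
      forall f g, contC f -> contC g -> (forall x, H x -> f x = g x) -> I f = I g &
      I (fun=> 1) = 1] /\
  (
      forall h f, H h -> contC f -> I (fun x => f (mul h x)) = I f).

Definition is_posdef {T : Type} (mul : T -> T -> T) (inv : T -> T) (g : T -> C) :=
  forall (n : nat) (xs : 'I_n -> T) (c : 'I_n -> C),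
    0 <= \sum_(j < n) \sum_(k < n) g (mul (inv (xs j)) (xs k)) * c j * (c k)^*.

Definition PD {T : topologicalType} (mul : T -> T -> T) (inv : T -> T)
  (g : T -> C) := contC g /\ is_posdef mul inv g.

Definition biK_invariant {T : Type} (mul : T -> T -> T) (K : set T) (g : T -> C) :=
  forall k l x, K k -> K l -> g (mul (mul k x) l) = g x.

Definition conv {T : Type} (mul : T -> T -> T) (inv : T -> T)
  (IG : (T -> C) -> C) (f g : T -> C) : T -> C :=
  fun x => IG (fun y => f y * g (mul (inv y) x)).

(* (G,K) Gelfand pair, G compact: every continuous function is compactly
   supported, so the condition is commutativity of convolution on continuous
   bi-K-invariant functions *)
Definition is_gelfand {T : topologicalType} (mul : T -> T -> T) (inv : T -> T)
  (IG : (T -> C) -> C) (K : set T) :=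
  forall f g : T -> C, contC f -> contC g ->
    biK_invariant mul K f -> biK_invariant mul K g ->
    conv mul inv IG f g = conv mul inv IG g f.

Definition is_spherical {T : topologicalType} (mul : T -> T -> T) (e : T)
  (IK : (T -> C) -> C) (phi : T -> C) :=
  [/\ contC phi, phi e = 1 &
      forall x y, IK (fun k => phi (mul (mul x k) y)) = phi x * phi y].

Definition Zset {T : topologicalType} (mul : T -> T -> T) (inv : T -> T) (e : T)
  (IK : (T -> C) -> C) : set (T -> C) :=
  [set phi | is_spherical mul e IK phi /\ PD mul inv phi].

Definition lin_indep {T : Type} (m : nat) (h : 'I_m -> T -> C) :=
  forall c : 'I_m -> C, (forall x, \sum_(i < m) c i * h i x = 0) ->
    forall i, c i = 0.

Definition translates {T : Type} (mul : T -> T -> T) (inv : T -> T)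
  (phi : T -> C) (m : nat) (gs : 'I_m -> T) : 'I_m -> T -> C :=
  fun i x => phi (mul (inv (gs i)) x).

Definition translate_span_dim {T : Type} (mul : T -> T -> T) (inv : T -> T)
  (phi : T -> C) (n : nat) :=
  (exists gs : 'I_n -> T, lin_indep (translates mul inv phi gs)) /\
  (forall gs : 'I_n.+1 -> T, ~ lin_indep (translates mul inv phi gs)).

Definition delta {T : Type} (mul : T -> T -> T) (inv : T -> T) (phi : T -> C)
  : nat := xget 0%N [set n | translate_span_dim mul inv phi n].

Definition Psharp {G L : topologicalType} (mulG : G -> G -> G) (invG : G -> G)
  (K : set G) (mulL : L -> L -> L) (invL : L -> L) (f : G * L -> C) :=
  [/\ contC f,
      is_posdef (fun p q : G * L => (mulG p.1 q.1, mulL p.2 q.2))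
                (fun p : G * L => (invG p.1, invL p.2)) f &
      forall k l x u, K k -> K l -> f (mulG (mulG k x) l, u) = f (x, u)].

Definition sum_pointwise {I : choiceType} {P : Type} (Z : set I)
  (a : I -> P -> C) (F : P -> C) :=
  forall p (eps : R), 0 < eps -> exists F0 : set I,
    [/\ finite_set F0, F0 `<=` Z &
      forall A : set I, finite_set A -> F0 `<=` A -> A `<=` Z ->
        `|F p - \sum_(i \in A) a i p| < (eps%:C)%C].

Definition sum_uniform {I : choiceType} {P : Type} (Z : set I)
  (a : I -> P -> C) (F : P -> C) :=
  forall (eps : R), 0 < eps -> exists F0 : set I,
    [/\ finite_set F0, F0 `<=` Z &
      forall A : set I, finite_set A -> F0 `<=` A -> A `<=` Z ->
        forall p, `|F p - \sum_(i \in A) a i p| < (eps%:C)%C].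

End Defs.

(* Main.v *)
(* A positive definite spherical function [phi] satisfies
   [phi * phi = |phi|_2^2 phi], and [g * phi = <g, phi> phi] for bi-invariant
   [g].  So distinct ones are orthogonal, and [phi / |phi|_2^2] is a
   self-adjoint idempotent, the reproducing kernel of the span of the translates
   of [phi]; its trace gives [delta phi = 1 / |phi|_2^2].  Positivity of [f]
   against the measure [delta_e - P], with [P] a finite sum of such idempotents,
   bounds the partial sums of [B phi e_L] by [f (e_G, e_L)], so the expansion
   converges uniformly by the M-test.

   Its sum is [f] because a bi-invariant function orthogonal to all [phi]
   vanishes.  This is proved without the spectral theorem: for [k = h * h^#]
   nonzero, the normalized convolution powers of [k * k] converge uniformly to
   an idempotent, by log-convexity of the norms of the powers of [k].  Below it
   lies a minimal idempotent of the commutative algebra, as nonzero idempotents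
   take values at least 1 at [e], and a minimal idempotent is a multiple of a
   positive definite spherical function not orthogonal to [h]. *)
Require Import Defs.
From mathcomp Require Import all_boot all_order all_algebra.
From mathcomp Require Import all_classical all_reals all_analysis.
From mathcomp Require Import complex ring lra zify.
Import Order.TTheory GRing.Theory Num.Theory numFieldNormedType.Exports.
Local Open Scope ring_scope.
Local Open Scope classical_set_scope.

Set Implicit Arguments.
Unset Strict Implicit.
Unset Printing Implicit Defensive.

(** * Continuous complex functions and means *)

(** The Haar integrals are given only as positive functionals on continuous functions. Fubini and
    the integrated forms of positive definiteness therefore come from Riemann sums attached to
    partitions of unity, and norm estimates from Cauchy-Schwarz. Continuous functions are not
    complete for the L2 norm. What replaces completeness is that a convolution is bounded uniformly
    by the L2 norms of its factors: one more convolution turns an L2 Cauchy sequence into a uniform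
    one. The limit of powers is also taken for arbitrary self-adjoint elements below a minimal
    idempotent [p]. Their eigenvalues may have both signs, so their own normalized powers could
    oscillate; this is why powers of [k * k] are used. The conclusion for such an element [g] is
    only that [g * g] is a multiple of [p], and a square root of the multiple is then split off. The
    functional equation for a minimal idempotent is obtained by showing that its defect is
    orthogonal to itself. *)

Section ConjFacts.
Variable C : numClosedFieldType.
Implicit Types x y : C.

Let conjD x y : (x + y)^* = x^* + y^*. Proof. exact: rmorphD. Qed.
Let conjB x y : (x - y)^* = x^* - y^*. Proof. exact: rmorphB. Qed.
Let conjN x : (- x)^* = - x^*. Proof. exact: rmorphN. Qed.
Let conjM x y : (x * y)^* = x^* * y^*. Proof. exact: rmorphM. Qed.
Let conjV x : (x^-1)^* = (x^*)^-1. Proof. exact: fmorphV. Qed.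
Definition conjE := (conjD, conjB, conjN, conjM, conjV, @conjCK C, @conjC0 C, @conjC1 C).

Lemma conj_sum (I : Type) (s : seq I) (P : pred I) (F : I -> C) :
  (\sum_(i <- s | P i) F i)^* = \sum_(i <- s | P i) (F i)^*.
Proof. exact: rmorph_sum. Qed.

Lemma ge0_conjC x : 0 <= x -> x^* = x.
Proof. by move=> x0; apply/CrealP/ger0_real. Qed.

End ConjFacts.

Section ApproxFacts.
Variable C : numClosedFieldType.

Lemma norm_small_eq0 (z : C) (k : C) :
  (forall e : C, 0 < e -> `|z| <= k * e) -> z = 0.
Proof.
move=> h; apply/eqP; rewrite -normr_eq0.
have k0 : 0 <= k by have := le_trans (normr_ge0 z) (h 1 ltr01); rewrite mulr1.
have k1 : 0 < k + 1 by rewrite ltr_wpDl.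
rewrite eq_le normr_ge0 andbT.
rewrite real_leNgt ?normr_real ?real0//; apply/negP => z0.
(* For this error the hypothesis reads [(k + 1) |z| <= k |z|]. *)
have e0 : 0 < `|z| / (k + 1) by rewrite divr_gt0.
have := h _ e0; rewrite mulrA ler_pdivlMr// mulrDr mulr1 mulrC gerDl.
by rewrite real_leNgt ?normr_real ?real0// z0.
Qed.

Lemma eq_of_close (a b k : C) :
  (forall e : C, 0 < e -> `|a - b| <= k * e) -> a = b.
Proof. by move=> /norm_small_eq0/eqP; rewrite subr_eq0 => /eqP. Qed.

(** The order of [C] is partial and [0 <= z] includes that [z] is real. Realness comes first, by
    comparing [z] and its conjugate with the same real [a]. *)
Lemma ge0_of_close (z k : C) :
  (forall e : C, 0 < e -> exists2 a : C, 0 <= a & `|z - a| <= k * e) -> 0 <= z.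
Proof.
move=> h.
have k0 : 0 <= k.
  have [a _] := h 1 ltr01; rewrite mulr1; exact: le_trans.
have zr : z^* = z.
  apply: (@eq_of_close _ _ (k + k)) => e e0; have [a a0 ha] := h _ e0.
  have -> : z^* - z = (z - a)^* - (z - a).
    have ar := ge0_conjC a0.
    by rewrite !conjE ar; ring.
  by rewrite mulrDl (le_trans (ler_normB _ _))// norm_conjC lerD.
have {}zr : z \is Num.real by apply/CrealP.
rewrite real_leNgt ?real0//; apply/negP => z0.
have k1 : 0 < k + 1 by rewrite ltr_wpDl.
have e0 : 0 < - z / (k + 1) by rewrite divr_gt0 ?oppr_gt0.
have [a a0] := h _ e0.
have -> : `|z - a| = a - z.
  by rewrite distrC ger0_norm// subr_ge0 ltW// (lt_le_trans z0).
rewrite mulrA ler_pdivlMr// => hh.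
have : - z * (k + 1) <= k * - z.
  by apply: le_trans hh; rewrite ler_wpM2r ?(ltW k1)// lerDr.
rewrite mulrDr mulr1 mulrC gerDl.
by rewrite real_leNgt ?real0 ?realN// oppr_gt0 z0.
Qed.

End ApproxFacts.

Section Contf.
Variables (C : numClosedFieldType) (T : topologicalType).
Implicit Types f g : T -> C.

(* [contC] for a general [C]; the two are convertible at [C = R[i]]. *)
Definition contf f : Prop := continuous (f : T -> C^o).

Lemma contfP f :
  contf f <-> forall x (e : C), 0 < e -> \forall y \near x, `|f x - f y| < e.
Proof.
split=> [cf x e e0|h x].
  by have /cvgrPdist_lt/(_ e e0) := cf x.
by apply/cvgrPdist_lt => e e0; exact: h.
Qed.

Lemma contf_cst (c : C) : contf (fun _ : T => c).
Proof. by move=> x; exact: cvg_cst. Qed.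

Lemma contfD f g : contf f -> contf g -> contf (fun x => f x + g x).
Proof. by move=> cf cg x; exact: (cvgD (cf x) (cg x)). Qed.

Lemma contfM f g : contf f -> contf g -> contf (fun x => f x * g x).
Proof. by move=> cf cg x; exact: (cvgM (cf x) (cg x)). Qed.

Lemma contfN f : contf f -> contf (fun x => - f x).
Proof. by move=> cf x; exact: (cvgN (cf x)). Qed.

Lemma contfB f g : contf f -> contf g -> contf (fun x => f x - g x).
Proof. by move=> cf cg x; exact: (cvgB (cf x) (cg x)). Qed.

Lemma contfV f : contf f -> (forall x, f x != 0) -> contf (fun x => (f x)^-1).
Proof. by move=> cf f0 x; exact: (cvgV (f0 x) (cf x)). Qed.

Lemma contf_conj f : contf f -> contf (fun x => (f x)^*).
Proof.
move=> /contfP cf; apply/contfP => x e /cf.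
move=> /(_ x); apply: filterS => y; by rewrite -rmorphB norm_conjC.
Qed.

End Contf.

Lemma contf_comp (C : numClosedFieldType) (S T : topologicalType) (h : S -> T) (f : T -> C) :
  continuous h -> contf f -> contf (fun x => f (h x)).
Proof. by move=> ch cf x; exact: (cvg_comp _ _ (ch x) (cf (h x))). Qed.

Opaque contf.

Section Contf2.
Variables (C : numClosedFieldType) (T : topologicalType).
Implicit Types f g : T -> C.

Lemma contf_sum (I : Type) (s : seq I) (F : I -> T -> C) :
  (forall i, contf (F i)) -> contf (fun x => \sum_(i <- s) F i x).
Proof.
move=> cF; elim: s => [|i s ih].
  rewrite (_ : (fun _ => _) = (fun=> 0)); first exact: contf_cst.
  by apply/funext => x; rewrite big_nil.
rewrite (_ : (fun _ => _) = (fun x => F i x + \sum_(i <- s) F i x)).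
  exact: contfD.
by apply/funext => x; rewrite big_cons.
Qed.

Lemma contf_unif_lim f (s : nat -> T -> C) :
  (forall n, contf (s n)) ->
  (forall e : C, 0 < e -> exists n, forall x, `|f x - s n x| <= e) -> contf f.
Proof.
move=> cs h; apply/contfP => x e e0.
have e4 : 0 < e / 4 by rewrite divr_gt0// ltr0n.
have [n hn] := h _ e4.
have /contfP/(_ x _ e4) := cs n; apply: filterS => y hy.
have -> : f x - f y = (f x - s n x) + (s n x - s n y) - (f y - s n y) by ring.
apply: le_lt_trans (ler_normB _ _) _.
apply: le_lt_trans (lerD (ler_normD _ _) (lexx _)) _.
apply: le_lt_trans (_ : _ <= e / 4 + e / 4 + e / 4) _.
  by rewrite !lerD ?hn ?(ltW hy).
rewrite -subr_gt0 (_ : e - _ = e / 4)//; by field.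
Qed.

End Contf2.

(** Follows the syntax of the body. Continuity of the atoms must be in the context, hence the many
    [have] that precede its calls. *)
Ltac cont :=
  lazymatch goal with
  | H : contf ?f |- contf ?f => exact: H
  | |- contf (fun x => @Algebra.add _ (@?f x) (@?g x)) =>
    refine (@contfD _ _ f g _ _); cont
  | |- contf (fun x => @Algebra.opp _ (@?f x)) => refine (@contfN _ _ f _); cont
  | |- contf (fun x => @GRing.mul _ (@?f x) (@?g x)) =>
    refine (@contfM _ _ f g _ _); cont
  | |- contf (fun x => @Num.conj _ (@?f x)) => refine (@contf_conj _ _ f _); cont
  | |- contf _ => 
    first [ assumption | exact: contf_cst
          | match goal with H : forall _, contf _ |- _ => solve [apply: H] end ]
  end.

Section Tube.
Variable C : numClosedFieldType.

(** The tube lemma: by compactness of [T], continuity at [x0] is uniform in the second variable. *)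
Lemma contf_tube (X T : topologicalType) (H : X * T -> C) :
  compact [set: T] -> contf H -> forall x0 (e : C), 0 < e ->
  \forall x \near x0, forall y, `|H (x0, y) - H (x, y)| < e.
Proof.
move=> cT /contfP cH x0 e e0.
have /compact_near_coveringP := cT.
move=> /(_ _ (nbhs x0) (fun x y => `|H (x0, y) - H (x, y)| < e) _) h.
have : \forall x \near x0, [set: T] `<=` (fun y => `|H (x0, y) - H (x, y)| < e).
  apply: h => y0 _.
  have e2 : 0 < e / 2 by rewrite divr_gt0// ltr0n.
  have [[A B] /= [nA nB] AB] := cH (x0, y0) _ e2.
  exists (B, A) => //= -[y x] /= [By Ax].
  have h1 := AB (x0, y) (conj (nbhs_singleton nA) By).
  have h2 := AB (x, y) (conj Ax By).
  have -> : H (x0, y) - H (x, y) =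
    (H (x0, y0) - H (x, y)) - (H (x0, y0) - H (x0, y)) by ring.
  by rewrite (le_lt_trans (ler_normB _ _))// (splitr e) ltrD.
by apply: filterS => x hx y; exact: hx.
Qed.

End Tube.

Section Mean.
Variables (C : numClosedFieldType) (T : topologicalType).
Implicit Types f g : T -> C.

(** A probability measure seen as a functional. Nothing is asked on discontinuous functions, so each
    use carries proofs of continuity. *)
Definition mean (I : (T -> C) -> C) :=
  [/\ forall f g, contf f -> contf g -> I (fun x => f x + g x) = I f + I g,
      forall (c : C) f, contf f -> I (fun x => c * f x) = c * I f,
      forall f, contf f -> (forall x, 0 <= f x) -> 0 <= I f &
      I (fun=> 1) = 1].

Variable I : (T -> C) -> C.
Hypothesis mI : mean I.

Lemma meanD f g : contf f -> contf g -> I (fun x => f x + g x) = I f + I g.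
Proof. by case: mI => h _ _ _; exact: h. Qed.
Lemma meanZ c f : contf f -> I (fun x => c * f x) = c * I f.
Proof. by case: mI => _ h _ _; exact: h. Qed.
Lemma mean_ge0 f : contf f -> (forall x, 0 <= f x) -> 0 <= I f.
Proof. by case: mI => _ _ h _; exact: h. Qed.
Lemma mean_cst c : I (fun=> c) = c.
Proof.
case: mI => _ hZ _ h1; rewrite -[RHS]mulr1 -h1 -hZ; last exact: contf_cst.
by congr I; apply/funext => x; rewrite mulr1.
Qed.
Lemma meanZr c f : contf f -> I (fun x => f x * c) = I f * c.
Proof.
by move=> cf; rewrite mulrC -meanZ//; congr I; apply/funext => x; rewrite mulrC.
Qed.
Lemma meanN f : contf f -> I (fun x => - f x) = - I f.
Proof.
move=> cf; rewrite -mulN1r -meanZ//; congr I.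
by apply/funext => x; rewrite mulN1r.
Qed.
Lemma meanB f g : contf f -> contf g -> I (fun x => f x - g x) = I f - I g.
Proof. by move=> cf cg; rewrite meanD ?meanN//; exact: contfN. Qed.
Lemma mean_sum (J : Type) (s : seq J) (F : J -> T -> C) :
  (forall i, contf (F i)) ->
  I (fun x => \sum_(i <- s) F i x) = \sum_(i <- s) I (F i).
Proof.
move=> cF; elim: s => [|i s ih].
  rewrite big_nil -[RHS](mean_cst 0); congr I.
  by apply/funext => x; rewrite big_nil.
rewrite big_cons -ih -meanD//; last exact: contf_sum.
by congr I; apply/funext => x; rewrite big_cons.
Qed.

(* A real function is a difference of squares:
   [4 f = (f + 1)^2 - (f - 1)^2]; this avoids boundedness of [f]. *)
Lemma mean_real f : contf f -> (forall x, f x \is Num.real) -> I f \is Num.real.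
Proof.
move=> cf rf.
have cp c : contf (fun x => (f x + c) ^+ 2).
  by apply: contfM; apply: contfD => //; exact: contf_cst.
have -> : I f = 4^-1 * (I (fun x => (f x + 1) ^+ 2) - I (fun x => (f x - 1) ^+ 2)).
  rewrite -meanB// -meanZ; last exact: contfB.
  by congr I; apply/funext => x; field.
rewrite rpredM ?rpredV ?realn// rpredB// ger0_real// mean_ge0// => x;
  by rewrite real_exprn_even_ge0// rpredD ?rpredB ?real1 ?realN.
Qed.

(** [f] plus its conjugate, and ['i] times their difference, are real valued, so their means are
    real. *)
Lemma mean_conj f : contf f -> I (fun x => (f x)^*) = (I f)^*.
Proof.
move=> cf; have cf' := contf_conj cf.
have a : (I f + I (fun x => (f x)^*)) \is Num.real.
  rewrite -meanD//; apply: mean_real; first exact: contfD.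
  by move=> x; apply/CrealP; rewrite !conjE addrC.
have b : ('i * (I f - I (fun x => (f x)^*))) \is Num.real.
  rewrite -meanB// -meanZ; last exact: contfB.
  apply: mean_real; first by apply: contfM; [exact: contf_cst | exact: contfB].
  move=> x; apply/CrealP.
  by rewrite !conjE conjCi; ring.
move: a b => /CrealP + /CrealP; set u := I f; set v := I _.
rewrite !conjE conjCi => h1 h2.
have {}h2 : u^* - v^* = - (u - v).
  apply: (mulfI (neq0Ci C)); rewrite mulrN -h2; ring.
have -> : u^* = ((u^* + v^*) + (u^* - v^*)) / 2 by field.
by rewrite h1 h2; field.
Qed.

Definition ip f g := I (fun x => f x * (g x)^*).

Lemma ipC f g : contf f -> contf g -> ip g f = (ip f g)^*.
Proof.
move=> cf cg; rewrite /ip -mean_conj; last by apply: contfM => //; exact: contf_conj.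
by congr I; apply/funext => x; rewrite !conjE mulrC.
Qed.

Lemma ip_ge0 f : contf f -> 0 <= ip f f.
Proof.
move=> cf; apply: mean_ge0; first by apply: contfM => //; exact: contf_conj.
by move=> x; rewrite mul_conjC_ge0.
Qed.

Lemma ip_subZ f g t : contf f -> contf g ->
  ip (fun x => f x - t * g x) (fun x => f x - t * g x) =
  ip f f - t^* * ip f g - t * (ip f g)^* + t * t^* * ip g g.
Proof.
move=> cf cg; have cf' := contf_conj cf; have cg' := contf_conj cg.
rewrite -ipC// /ip.
rewrite -!meanZ; try by cont.
rewrite -meanB; try by cont.
rewrite -meanB; try by cont.
rewrite -meanD; try by cont.
by congr I; apply/funext => x; rewrite !conjE; ring.
Qed.

Lemma cauchy_schwarz f g : contf f -> contf g ->
  `|ip f g| ^+ 2 <= ip f f * ip g g.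
Proof.
move=> cf cg.
have h t : 0 <= ip f f - t^* * ip f g - t * (ip f g)^* + t * t^* * ip g g.
  rewrite -ip_subZ//; apply: ip_ge0; apply: contfB => //.
  by apply: contfM => //; exact: contf_cst.
have a0 := ip_ge0 cf; have d0 := ip_ge0 cg.
rewrite normCK; set b := ip f g in h *; set a := ip f f in h a0 *.
set d := ip g g in h d0 *.
have dr := ge0_conjC d0.
have [d0'|dn0] := eqVneq d 0.
  rewrite d0' mulr0; have [->|b0] := eqVneq b 0; first by rewrite mul0r.
  have bb : 0 < b * b^* by rewrite mul_conjC_gt0.
  have ar := ge0_conjC a0.
  (* When [d = 0] the form is unbounded below in the direction of [b]; this [t] gives it the value
     -1. *)
  have := h ((a + 1) / (2 * (b * b^*)) * b).
  rewrite !conjE ar d0' mulr0 addr0.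
  rewrite (_ : _ - _ = -1) ?oppr_ge0 ?ler10//. 
  have b1 : b^* != 0 by rewrite conjC_eq0.
  by field; apply/andP.
have d1 : 0 < d by rewrite lt0r dn0.
(* The minimizer of the form. *)
have := h (b / d).
rewrite !conjE dr.
rewrite (_ : _ + _ = a - b * b^* / d); last by field.
by rewrite subr_ge0 ler_pdivrMr.
Qed.

(** Cauchy-Schwarz against the constant 1 bounds the square of [|I f|] by the mean of the square of
    [|f|]. *)
Lemma mean_norm_le f (M : C) : contf f -> (forall x, `|f x| <= M) -> `|I f| <= M.
Proof.
move=> cf fM.
(* A bound [M] that is not nonnegative is possible only on an empty [T], which [I 1 = 1]
   excludes. *)
have [M0|M0] := boolP (0 <= M); last first.
  have h := fM; suff : [set: T] = set0.
    move=> T0; have := mean_cst 1.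
    rewrite (_ : (fun=> 1) = (fun=> 0)) ?mean_cst; last first.
      by apply/funext => x; have : [set: T] x by []; rewrite T0.
    by move/eqP; rewrite eq_sym oner_eq0.
  by apply/seteqP; split => // x _; have := le_trans (normr_ge0 _) (fM x); rewrite (negbTE M0).
have c1 : contf (fun _ : T => (1 : C)) by exact: contf_cst.
have := cauchy_schwarz cf c1; rewrite {1 3}/ip.
have e1 h : I (fun x => h x * (1 : C)^*) = I h.
  by congr I; apply/funext => x; rewrite conjC1 mulr1.
rewrite (e1 f) (e1 (fun=> 1)) mean_cst mulr1 => h.
rewrite -(@ler_pXn2r _ 2) ?nnegrE//; apply: le_trans h _.
rewrite -(mean_cst (M ^+ 2)) -subr_ge0.
have cff : contf (fun x => f x * (f x)^*) by apply: contfM => //; exact: contf_conj.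
rewrite -meanB//; last exact: contf_cst.
apply: mean_ge0; first by apply: contfB => //; exact: contf_cst.
by move=> x; rewrite subr_ge0 -normCK ler_pXn2r ?nnegrE.
Qed.

Lemma ip_le f (M : C) : contf f -> (forall x, `|f x| ^+ 2 <= M) -> ip f f <= M.
Proof.
move=> cf fM; rewrite -(mean_cst M) -subr_ge0 /ip -meanB; try by cont.
apply: mean_ge0; first by cont.
by move=> x; rewrite subr_ge0 -normCK.
Qed.

Hypothesis cT : compact [set: T].

Lemma mean_cont (X : topologicalType) (H : X * T -> C) :
  contf H -> contf (fun x => I (fun y => H (x, y))).
Proof.
move=> cH; apply/contfP => x e e0.
have e2 : 0 < e / 2 by rewrite divr_gt0// ltr0n.
have := contf_tube cT cH x e2; apply: filterS => z hz.
have cz w : contf (fun y => H (w, y)).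
  by apply: contf_comp cH => y; apply: cvg_pair; [exact: cvg_cst|exact: cvg_id].
rewrite -meanB//; apply: le_lt_trans (_ : _ <= e / 2) _.
  by apply: mean_norm_le => [|y]; [exact: contfB|exact: ltW].
by rewrite ltr_pdivrMr ?ltr0n// mulr_natr mulr2n ltrDl.
Qed.

End Mean.

(** * Partitions of unity, Fubini, positive definiteness and Haar means *)

Section Slices.
Variable C : numClosedFieldType.

Lemma continuous_pair (X S T : topologicalType) (a : X -> S) (b : X -> T) :
  continuous a -> continuous b -> continuous (fun x => (a x, b x)).
Proof. by move=> ca cb x; apply: cvg_pair; [exact: ca|exact: cb]. Qed.

Lemma contf_comp2 (X S T : topologicalType) (H : S * T -> C) (a : X -> S) (b : X -> T) :
  continuous a -> continuous b -> contf H -> contf (fun x => H (a x, b x)).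
Proof. by move=> ca cb cH; apply: contf_comp cH; exact: continuous_pair. Qed.

Lemma contf_slicer (S T : topologicalType) (H : S * T -> C) x :
  contf H -> contf (fun y => H (x, y)).
Proof. by apply: contf_comp2 => y; [exact: cvg_cst|exact: cvg_id]. Qed.

Lemma contf_slicel (S T : topologicalType) (H : S * T -> C) y :
  contf H -> contf (fun x => H (x, y)).
Proof. by apply: contf_comp2 => x; [exact: cvg_id|exact: cvg_cst]. Qed.

Lemma contf_swap (S T : topologicalType) (H : S * T -> C) :
  contf H -> contf (fun p => H (p.2, p.1)).
Proof. by apply: contf_comp2 => x; [exact: cvg_snd|exact: cvg_fst]. Qed.

Lemma mean_contl (X T : topologicalType) (I : (T -> C) -> C) (H : T * X -> C) :
  mean I -> compact [set: T] -> contf H -> contf (fun x => I (fun y => H (y, x))).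
Proof.
by move=> mI cT /contf_swap cH; exact: (mean_cont mI cT cH).
Qed.

End Slices.

Section Covering.
Variable T : topologicalType.
Hypothesis cT : compact [set: T].

(** Finite subcovers, read off from compactness along the filter of sequences ordered by
    inclusion. *)
Lemma compact_finite_seq (J : eqType) (P : seq J -> T -> Prop) :
  (forall (s s' : seq J) x, {subset s <= s'} -> P s x -> P s' x) ->
  (forall x : T, exists s, \forall y \near x, P s y) -> exists s, forall x, P s x.
Proof.
move=> mP hP.
pose F : set_system (seq J) :=
  fun S : set (seq J) => exists s0 : seq J, forall s : seq J, {subset s0 <= s} -> S s.
have FF : Filter F.
  split.
  - by exists [::].
  - move=> A B [a hA] [b hB]; exists (a ++ b) => s hs; split.
      by apply: hA => z za; apply: hs; rewrite mem_cat za.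
    by apply: hB => z zb; apply: hs; rewrite mem_cat zb orbT.
  - by move=> A B AB [a hA]; exists a => s /hA/AB.
have /compact_near_coveringP/(_ _ F P FF) := cT.
case=> [x _|s hs].
  have [s hs] := hP x.
  exists ([set y | P s y], [set t : seq J | {subset s <= t}]) => /=.
    by split => //; exists s.
  by move=> [y s'] /= [Py ss']; exact: mP ss' Py.
by exists s => x; exact: (hs s).
Qed.

End Covering.

Section Partition.
Variables (C : numClosedFieldType) (T : topologicalType).

(** The form in which separation enters; on a compact Hausdorff space it is Urysohn's lemma. *)
Definition bumps := forall (y : T) (U : set T), nbhs y U ->
  exists g : T -> C, [/\ contf g, forall x, 0 <= g x, g y = 1 &
    forall x, g x != 0 -> U x].

Hypotheses (cT : compact [set: T]) (bT : bumps).

(** Bumps living where [H x] varies by less than [e] are divided by a finite sum of them that is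
    positive everywhere. The parameter [x] ranges over a bare type, so that one partition can serve
    several families of functions at once. *)
Lemma partition_of_unity (X : Type) (H : X -> T -> C) (e : C) : 0 < e ->
  (forall y : T, \forall z \near y, forall x, `|H x y - H x z| < e) ->
  exists (s : seq T) (phi : T -> T -> C),
  [/\ forall y, contf (phi y), forall y z, 0 <= phi y z,
      forall z, \sum_(y <- s) phi y z = 1 &
      forall x z, `|H x z - \sum_(y <- s) phi y z * H x y| <= e].
Proof.
move=> e0 hH.
have /choice[g hg] : forall y, exists g : T -> C,
    [/\ contf g, forall x, 0 <= g x, g y = 1 &
     forall z, g z != 0 -> forall x, `|H x y - H x z| < e].
  by move=> y; exact: (bT (hH y)).
have cg y : contf (g y) by case: (hg y).
have g0 y x : 0 <= g y x by case: (hg y).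
have [s hs] : exists s, forall z, 0 < \sum_(y <- s) g y z.
  apply: (compact_finite_seq cT) => [s s' z ss'|z].
    move=> sz.
    (* Inclusion of sequences ignores multiplicities; positivity passes to [s'] through a single
       nonzero term. *)
    have [y ys gy] : exists2 y, y \in s & g y z != 0.
      have [/hasP[y ys gy]|/hasPn h] := boolP (has (fun y => g y z != 0) s).
        by exists y.
      by move: sz; rewrite big_seq big1 ?ltxx// => i /h; rewrite negbK => /eqP.
    rewrite (perm_big _ (perm_to_rem (ss' _ ys))) big_cons ltr_pwDl ?sumr_ge0//.
    by rewrite lt0r gy g0.
  exists [:: z].
  have [/contfP cgz _ gz _] := hg z.
  have := cgz z _ ltr01; apply: filterS => y; rewrite gz big_seq1 => h.
  rewrite lt0r g0 andbT; apply/eqP => gy0; move: h.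
  by rewrite gy0 subr0 normr1 ltxx.
pose S z := \sum_(y <- s) g y z.
have S0 z : S z != 0 by rewrite gt_eqF ?hs.
exists s, (fun y z => g y z / S z); split.
- by move=> y; apply: contfM => //; apply: contfV => //; exact: contf_sum.
- by move=> y z; rewrite divr_ge0// ltW// hs.
- by move=> z; rewrite -mulr_suml -/(S _) (divff (S0 z)).
- move=> x z.
  have -> : H x z - \sum_(y <- s) g y z / S z * H x y =
            \sum_(y <- s) g y z / S z * (H x z - H x y).
    under [RHS]eq_bigr do rewrite mulrBr.
    by rewrite sumrB -mulr_suml -mulr_suml -/(S z) (divff (S0 z)) mul1r.
  have -> : e = \sum_(y <- s) g y z / S z * e by rewrite -!mulr_suml -/(S z) (divff (S0 z)) mul1r.
  apply: le_trans (ler_norm_sum _ _ _) _; apply: ler_sum => y _.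
  have p0 : 0 <= g y z / S z by rewrite divr_ge0// ltW// hs.
  rewrite normrM ger0_norm//; have [->|gn0] := eqVneq (g y z) 0.
    by rewrite !mul0r.
  rewrite ler_wpM2l// distrC ltW//; case: (hg y) => _ _ _; exact.
Qed.

Lemma mean_riemann (I : (T -> C) -> C) (s : seq T) (phi : T -> T -> C) h (e : C) :
  mean I -> contf h -> (forall y, contf (phi y)) ->
  (forall z, `|h z - \sum_(y <- s) phi y z * h y| <= e) ->
  `|I h - \sum_(y <- s) I (phi y) * h y| <= e.
Proof.
move=> mI ch cphi hh.
have cp y : contf (fun z => phi y z * h y) by cont.
have -> : \sum_(y <- s) I (phi y) * h y = I (fun z => \sum_(y <- s) phi y z * h y).
  by rewrite mean_sum//; apply: eq_bigr => y _; rewrite meanZr.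
have cs : contf (fun z => \sum_(y <- s) phi y z * h y) by exact: contf_sum.
by rewrite -meanB//; apply: mean_norm_le => //; cont.
Qed.

(** Both iterated means are within [e] of the same Riemann sum [A] in [y], because the partition
    works for all [x]. *)
Lemma fubini (I J : (T -> C) -> C) (H : T * T -> C) :
  mean I -> mean J -> contf H ->
  I (fun x => J (fun y => H (x, y))) = J (fun y => I (fun x => H (x, y))).
Proof.
move=> mI mJ cH; apply: (@eq_of_close _ _ _ 2) => e e0.
have cHr x : contf (fun y => H (x, y)) by exact: contf_slicer.
have cHl y : contf (fun x => H (x, y)) by exact: contf_slicel.
have cJ : contf (fun x => J (fun y => H (x, y))) by exact: (mean_cont mJ cT cH).
have cI : contf (fun y => I (fun x => H (x, y))) by exact: (mean_contl mI cT cH).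
have [|s [phi [cphi phi0 phi1 hs]]] :=
    @partition_of_unity _ (fun x y => H (x, y)) e e0.
  by move=> y; exact: (contf_tube cT (contf_swap cH) y e0).
set A := \sum_(y <- s) J (phi y) * I (fun x => H (x, y)).
have h1 : `|I (fun x => J (fun y => H (x, y))) - A| <= e.
  have cp y : contf (fun x => J (phi y) * H (x, y)) by cont.
  have -> : A = I (fun x => \sum_(y <- s) J (phi y) * H (x, y)).
    by rewrite mean_sum//; apply: eq_bigr => y _; rewrite meanZ.
  have cs : contf (fun z => \sum_(y <- s) J (phi y) * H (z, y)) by exact: contf_sum.
  rewrite -meanB//; apply: mean_norm_le => //; first by cont.
  by move=> x; apply: mean_riemann.
have h2 : `|J (fun y => I (fun x => H (x, y))) - A| <= e.
  apply: mean_riemann => // z.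
  have cp y : contf (fun x => phi y z * H (x, y)) by cont.
  rewrite (_ : \sum_(y <- s) _ = I (fun x => \sum_(y <- s) phi y z * H (x, y))); last first.
    by rewrite mean_sum//; apply: eq_bigr => y _; rewrite meanZ.
  have cs : contf (fun x => \sum_(y <- s) phi y z * H (x, y)) by exact: contf_sum.
  by rewrite -meanB//; apply: mean_norm_le => //; cont.
move: h1 h2; set a := I _; set b := J _ => h1 h2.
rewrite (_ : a - b = (a - A) - (b - A)); last by ring.
by rewrite (le_trans (ler_normB _ _))// mulr_natl mulr2n lerD.
Qed.

(** The double mean is a limit of quadratic forms with probability weights. The normalization of the
    weights lets kernels with a constant term be treated, as in [posdef_ip_le]. *)
Lemma mean2_ge0 (I : (T -> C) -> C) (H : T * T -> C) : mean I -> contf H ->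
  (forall (s : seq T) (w : T -> C), (forall y, 0 <= w y) -> \sum_(y <- s) w y = 1 ->
     0 <= \sum_(x <- s) \sum_(y <- s) w x * w y * H (x, y)) ->
  0 <= I (fun x => I (fun y => H (x, y))).
Proof.
move=> mI cH hw; apply: (@ge0_of_close _ _ 2) => e e0.
have cHr x : contf (fun y => H (x, y)) by exact: contf_slicer.
have cHl y : contf (fun x => H (x, y)) by exact: contf_slicel.
have cI : contf (fun x => I (fun y => H (x, y))) by exact: (mean_cont mI cT cH).
(* The sum type indexes rows and columns of [H] together, so that one partition approximates both
   means. *)
pose H' (x : T + T) (y : T) := match x with inl x => H (x, y) | inr x => H (y, x) end.
have [|s [phi [cphi phi0 phi1 hs]]] := @partition_of_unity _ H' e e0.
  move=> y; apply: filterS2 (contf_tube cT (contf_swap cH) y e0) (contf_tube cT cH y e0).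
  by move=> z h1 h2 [x|x]; [exact: h1|exact: h2].
pose w y := I (phi y).
have w0 y : 0 <= w y by exact: mean_ge0.
exists (\sum_(x <- s) \sum_(y <- s) w x * w y * H (x, y)).
  apply: hw => //; rewrite /w -mean_sum// -(mean_cst mI 1); congr I.
  by apply/funext => z; rewrite phi1.
set a := I _; set A := \sum_(x <- s) _.
pose B := \sum_(y <- s) w y * I (fun x => H (x, y)).
have h1 : `|a - B| <= e.
  have cp y : contf (fun x => w y * H (x, y)) by cont.
  have -> : B = I (fun x => \sum_(y <- s) w y * H (x, y)).
    by rewrite mean_sum//; apply: eq_bigr => y _; rewrite meanZ.
  have cs : contf (fun z => \sum_(y <- s) w y * H (z, y)) by exact: contf_sum.
  rewrite -meanB//; apply: mean_norm_le => //; first by cont.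
  by move=> x; apply: mean_riemann => // z; exact: (hs (inl x)).
have h2 : `|B - A| <= e.
  rewrite /A exchange_big /= -sumrB.
  have -> : e = \sum_(y <- s) w y * e.
    rewrite -mulr_suml -mean_sum// (_ : I _ = 1) ?mul1r//.
    by rewrite -(mean_cst mI 1); congr I; apply/funext => z; rewrite phi1.
  apply: le_trans (ler_norm_sum _ _ _) _; apply: ler_sum => y _.
  rewrite (_ : _ - _ = w y * (I (fun x => H (x, y)) - \sum_(x <- s) w x * H (x, y))).
    rewrite normrM ger0_norm// ler_wpM2l//.
    by apply: mean_riemann => // z; exact: (hs (inr y)).
  by rewrite mulrBr mulr_sumr; congr (_ - _); apply: eq_bigr => x _; ring.
rewrite (_ : a - A = (a - B) + (B - A)); last by ring.
by rewrite (le_trans (ler_normD _ _))// mulr_natl mulr2n lerD.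
Qed.

End Partition.

Section PosDef.
Variables (C : numClosedFieldType) (T : Type) (mul : T -> T -> T) (inv : T -> T) (e : T).

Definition posdef (g : T -> C) :=
  forall (n : nat) (xs : 'I_n -> T) (c : 'I_n -> C),
    0 <= \sum_(j < n) \sum_(k < n) g (mul (inv (xs j)) (xs k)) * c j * (c k)^*.

Lemma posdef_seq (g : T -> C) (J : Type) (s : seq J) (x : J -> T) (c : J -> C) :
  posdef g ->
  0 <= \sum_(j <- s) \sum_(k <- s) g (mul (inv (x j)) (x k)) * c j * (c k)^*.
Proof.
move=> pg; rewrite big_tnth; under eq_bigr do rewrite big_tnth.
exact: (pg _ (fun i => x (tnth (in_tuple s) i)) (fun i => c (tnth (in_tuple s) i))).
Qed.

Hypothesis gT : is_group mul inv e.

Lemma ginvK x : inv (inv x) = x.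
Proof.
case: gT => a l r li ri.
by rewrite -[LHS]r -(li x) a li l.
Qed.

Lemma ginvM x y : inv (mul x y) = mul (inv y) (inv x).
Proof.
case: gT => a l r li ri.
have h : mul (mul x y) (mul (inv y) (inv x)) = e.
  by rewrite a -[mul (mul x y) _]a ri r ri.
by rewrite -[LHS]r -h a li l.
Qed.

Lemma ginv1 : inv e = e.
Proof. by case: gT => a l r li ri; rewrite -[LHS]r li. Qed.

Lemma gmulKV x y : mul x (mul (inv x) y) = y.
Proof. by case: gT => a l r li ri; rewrite a ri l. Qed.
Lemma gmulVK x y : mul (inv x) (mul x y) = y.
Proof. by case: gT => a l r li ri; rewrite a li l. Qed.
Lemma gmulVKr x y : mul (mul x (inv y)) y = x.
Proof. by case: gT => a l r li ri; rewrite -a li r. Qed.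
Variable g : T -> C.
Hypothesis pg : posdef g.

(** The points [e] and [x] with coefficients 1 and [c]: the next three lemmas are choices of [c]. *)
Let pd2 x c : 0 <= g e + g x * c^* + (g (inv x) * c + g e * c * c^*).
Proof.
case: gT => a l r li ri.
have := @posdef_seq g _ [:: (e, 1); (x, c)] fst snd pg.
rewrite !big_cons !big_nil /= !addr0 ginv1 !l r li conjC1 !mulr1; exact.
Qed.

Lemma posdef_e_ge0 : 0 <= g e.
Proof. by have := pd2 e 0; rewrite conjC0 !mulr0 !addr0. Qed.

(** The two-point form is real at [c = 1] and at [c = 'i]; this gives two linear relations between
    [g x], [g (inv x)] and their conjugates. *)
Lemma posdefV x : g (inv x) = (g x)^*.
Proof.
have ae := ge0_conjC posdef_e_ge0.
have := ge0_conjC (pd2 x 1); have := ge0_conjC (pd2 x 'i).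
rewrite !conjE ae conjCi !mulr1.
set u := g x; set v := g (inv x) => h1 h2.
have {}h2 : u^* + v^* = u + v.
  apply: (addrI (g e + g e)); rewrite addrACA [g e + v^*]addrC h2; ring.
have {}h1 : u^* - v^* = v - u.
  apply: (mulIf (neq0Ci C)); apply: (addrI (g e - g e * 'i * 'i)).
  rewrite (_ : _ + (v - u) * 'i = g e + u * - 'i + (v * 'i + g e * 'i * - 'i)).
    by rewrite -h1; ring.
  ring.
rewrite -[v](mulfK (_ : 2 != 0)) ?pnatr_eq0//.
rewrite (_ : v * 2 = (u + v) + (v - u)); last by ring.
by rewrite -h1 -h2; field.
Qed.

Lemma posdef_norm_le x : `|g x| <= g e.
Proof.
have [->|b0] := eqVneq (g x) 0; first by rewrite normr0 posdef_e_ge0.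
have n0 : `|g x| != 0 by rewrite normr_eq0.
(* This coefficient of modulus 1 turns the form into [2 (g e - |g x|)]. *)
have := pd2 x (- (g x / `|g x|)); rewrite posdefV !conjE (ge0_conjC (normr_ge0 _)).
have -> : (g x)^* = `|g x| ^+ 2 / g x by rewrite normCK mulrC mulKf.
move: n0 b0; set n : C := `|g x|; set b := g x; set a := g e => n0 b0.
have -> : a + b * - (n ^+ 2 / b / n) + (n ^+ 2 / b * - (b / n) +
  a * - (b / n) * - (n ^+ 2 / b / n)) = 2 * (a - n) by field; rewrite b0 n0.
by rewrite pmulr_rge0 ?subr_ge0 ?ltr0n.
Qed.

End PosDef.

Section Haar.
Variables (C : numClosedFieldType) (G : topologicalType).
Variables (mul : G -> G -> G) (inv : G -> G) (e : G).
Hypotheses (gG : is_group mul inv e) (cmul : continuous (fun p : G * G => mul p.1 p.2))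
  (cinv : continuous inv) (cG : compact [set: G]) (bG : bumps C G).

Lemma contf_mul (X : topologicalType) (f : G -> C) (a b : X -> G) :
  continuous a -> continuous b -> contf f -> contf (fun x => f (mul (a x) (b x))).
Proof.
move=> ca cb cf; apply: (@contf_comp2 _ _ _ _ (fun p => f (mul p.1 p.2))) => //.
exact: (contf_comp cmul cf).
Qed.

Lemma contf_mulr f x : contf f -> contf (fun y => f (mul x y) : C).
Proof. by move=> cf; apply: contf_mul cf => y; [exact: cvg_cst|exact: cvg_id]. Qed.
Lemma contf_mull f x : contf f -> contf (fun y => f (mul y x) : C).
Proof. by move=> cf; apply: contf_mul cf => y; [exact: cvg_id|exact: cvg_cst]. Qed.
Lemma contf_inv f : contf f -> contf (fun y => f (inv y) : C).
Proof. exact: contf_comp. Qed.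

Lemma mean_inv I : mean I -> mean (fun f : G -> C => I (fun x => f (inv x))).
Proof.
move=> mI; split.
- by move=> f g cf cg; rewrite meanD//; exact: contf_inv.
- by move=> c f cf; rewrite meanZ//; exact: contf_inv.
- by move=> f cf f0; apply: mean_ge0 => //; exact: contf_inv.
- exact: mean_cst.
Qed.

Section Sub.
Variables (H : set G) (I : (G -> C) -> C).
Hypotheses (mI : mean I) (HV : forall x, H x -> H (inv x))
 (suppI : forall f g, contf f -> contf g -> (forall x, H x -> f x = g x) -> I f = I g)
 (invI : forall h f, H h -> contf f -> I (fun x => f (mul h x)) = I f).

(* Both sides equal the iterated mean of [f (y x)] over [x] for [I] and over
   [y] for the reflected mean, in the two orders. *)
Lemma haar_inv f : contf f -> I (fun x => f (inv x)) = I f.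
Proof.
move=> cf; have mJ := mean_inv mI.
have cF : contf (fun p : G * G => f (mul p.2 p.1)).
  by apply: contf_mul cf => p; [exact: cvg_snd|exact: cvg_fst].
have := fubini cG bG mI mJ cF; rewrite /=.
have cF' : contf (fun p : G * G => f (mul (inv p.2) p.1)).
  apply: contf_mul cf => p; last exact: cvg_fst.
  by apply: (continuous_comp (f := snd)); [exact: cvg_snd|exact: cinv].
have -> : I (fun x => I (fun y => f (mul (inv y) x))) = I (fun x => f (inv x)).
  rewrite -[RHS](mean_cst mI); apply: suppI; [|exact: contf_cst|].
    exact: (mean_cont mI cG cF').
  move=> x Hx; rewrite -[RHS](invI (HV Hx)); last exact: contf_inv.
  by congr I; apply/funext => y; rewrite (ginvM gG) (ginvK gG).
move=> ->; rewrite -[RHS](mean_cst mI); apply: suppI; [|exact: contf_cst|].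
  exact: (mean_contl mI cG cF').
by move=> y Hy; apply: invI => //; exact: HV.
Qed.

Lemma haar_mulr h f : H h -> contf f -> I (fun x => f (mul x h)) = I f.
Proof.
move=> Hh cf; rewrite -haar_inv; last exact: contf_mull.
rewrite -[RHS]haar_inv// -[RHS](invI (HV Hh)); last exact: contf_inv.
by congr I; apply/funext => x; rewrite (ginvM gG) (ginvK gG).
Qed.
End Sub.

(** By compactness finitely many translates of [f] add up to at least [f x0 / 2] everywhere, while
    each of them has mean [I f = 0]. *)
Lemma haar_eq0 (I : (G -> C) -> C) (f : G -> C) : mean I ->
  (forall h (f : G -> C), contf f -> I (fun x => f (mul h x)) = I f) ->
  contf f -> (forall x, 0 <= f x) -> I f = 0 -> forall x, f x = 0.
Proof.
move=> mI invI cf f0 If0 x0; apply/eqP/negPn/negP => fx0.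
have fx : 0 < f x0 by rewrite lt0r fx0 f0.
have e0 : 0 < f x0 / 2 by rewrite divr_gt0// ltr0n.
(* [undup] makes the sum monotone under inclusion of sequences. *)
have [s hs] : exists s, forall z, f x0 / 2 <= \sum_(y <- undup s) f (mul y z).
  apply: (compact_finite_seq cG) => [s s' z ss' h|z].
    apply: le_trans h _.
    rewrite [leRHS](bigID (mem s)) /= -[leLHS]addr0 lerD ?sumr_ge0//.
    rewrite -[leRHS]big_filter.
    rewrite (perm_big [seq y <- undup s' | y \in s])//.
    apply: uniq_perm; rewrite ?undup_uniq ?filter_uniq ?undup_uniq//.
    move=> y; rewrite mem_filter !mem_undup; apply/idP/andP => [ys|[]//].
    by split=> //; exact: ss'.
  exists [:: mul x0 (inv z)].
  have /contfP/(_ z _ e0) := contf_mulr (x := mul x0 (inv z)) cf.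
  apply: filterS => y; rewrite /= big_seq1 (gmulVKr gG) => h.
  have r : f x0 - f (mul (mul x0 (inv z)) y) \is Num.real.
    by rewrite rpredB// ger0_real.
  move: h; rewrite real_ltr_norml// => /andP[_].
  rewrite ltrBlDr -ltrBlDl => /ltW; apply: le_trans.
  by rewrite {2}(splitr (f x0)) addrK.
have cS : contf (fun z => \sum_(y <- undup s) f (mul y z)).
  by apply: contf_sum => y; exact: contf_mulr.
have : 0 <= I (fun z => \sum_(y <- undup s) f (mul y z) - f x0 / 2).
  by apply: mean_ge0 => // [|z]; [cont|rewrite subr_ge0].
rewrite meanB//; last exact: contf_cst.
rewrite (mean_cst mI) (mean_sum mI); last by move=> y; exact: contf_mulr.
rewrite big1; last by move=> y _; rewrite invI.
by rewrite sub0r oppr_ge0 => h; have := lt_le_trans e0 h; rewrite ltxx.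
Qed.

End Haar.

(** * Growth rates and limits *)

Section RealSeq.
Variable R : realType.

(** The limit is built as a lower limit: the supremum of the numbers that are eventually below
    [u]. *)
Lemma real_cauchy_lim (u : nat -> R) :
  (forall e, 0 < e -> exists N, forall m n, (N <= m)%N -> (N <= n)%N -> `|u m - u n| <= e) ->
  exists l, forall e, 0 < e -> exists N, forall n, (N <= n)%N -> `|l - u n| <= e.
Proof.
move=> cu.
pose S : set R := [set x | exists N, forall n, (N <= n)%N -> x <= u n].
have inS e : 0 < e -> exists N, S (u N - e) /\ ubound S (u N + e).
  move=> /cu[N hN]; exists N; split.
    by exists N => n /(hN _ _ (leqnn _)); rewrite ler_norml => /andP[_]; lra.
  move=> x [M hM]; have := hM _ (leq_maxl M N).
  have := hN _ _ (leqnn _) (leq_maxr M N); rewrite ler_norml => /andP[]; lra.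
exists (sup S) => e e0; have e2 : 0 < e / 2 by lra.
have [N [SN uN]] := inS _ e2; have [M hM] := cu _ e2.
have [a0 a1] : u N - e / 2 <= sup S /\ sup S <= u N + e / 2.
  split; first by apply: ub_le_sup => //; exists (u N + e / 2).
  by apply: ge_sup => //; exists (u N - e / 2).
have hs n : (M <= n)%N -> (N <= n)%N -> `|sup S - u n| <= e.
  move=> Mn Nn; have [K hK] := cu _ e2.
  rewrite ler_norml; apply/andP; split.
    have : u n - e / 2 <= sup S.
      apply: ub_le_sup; first by exists (u N + e / 2).
      by exists M => m Mm; have := hM _ _ Mn Mm; rewrite ler_norml => /andP[_]; lra.
    lra.
  have : sup S <= u n + e / 2.
    apply: ge_sup; first by exists (u N - e / 2).
    move=> x [P hP]; have := hP _ (leq_maxl P M).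
    have := hM _ _ Mn (leq_maxr P M); rewrite ler_norml => /andP[]; lra.
  lra.
by exists (maxn M N) => n; rewrite geq_max => /andP[]; exact: hs.
Qed.

(* The growth rate [mu] of a log-convex submultiplicative sequence
   (with [a n] standing for the term of index [n + 1]) is a supremum of ratios,
   and [a n / mu ^+ n.+1] decreases to a limit which is at least 1. *)
Lemma growth_rate (a : nat -> R) :
  (forall n, 0 < a n) -> (forall n, a n.+1 ^+ 2 <= a n * a n.+2) ->
  (forall m n, a (m + n).+1 <= a m * a n) ->
  exists mu beta : R, [/\ 0 < mu, 1 <= beta, forall n, beta <= a n / mu ^+ n.+1 &
    forall eps : R, 0 < eps -> exists N, forall n, (N <= n)%N -> a n / mu ^+ n.+1 <= beta + eps].
Proof.
move=> a0 acv asub.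
pose r n := a n.+1 / a n.
have r0 n : 0 < r n by rewrite divr_gt0.
have rS n : r n <= r n.+1.
  by rewrite /r ler_pdivrMr// mulrAC ler_pdivlMr// -expr2 mulrC.
have rle m n : (m <= n)%N -> r m <= r n.
  elim: n => [|n ih]; first by rewrite leqn0 => /eqP ->.
  by rewrite leq_eqVlt => /predU1P[->//|/ih h]; exact: le_trans h (rS n).
have ra n : r n <= a 0.
  by rewrite /r ler_pdivrMr//; have := asub 0%N n; rewrite add0n.
pose S : set R := range r.
have supS : has_sup S by split; [exists (r 0%N), 0%N | exists (a 0%N) => _ [n _ <-]].
pose mu := sup S.
have rmu n : r n <= mu by apply: ub_le_sup; [case: supS|exists n].
have mu0 : 0 < mu := lt_le_trans (r0 0%N) (rmu 0%N).
have aexp m n : a m * r m ^+ n <= a (m + n)%N.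
  elim: n => [|n ih]; first by rewrite expr0 mulr1 addn0.
  rewrite exprSr mulrA addnS.
  apply: le_trans (_ : _ <= a (m + n)%N * r (m + n)%N) _.
    apply: ler_pM => //; last by apply: rle; exact: leq_addr.
      by rewrite mulr_ge0 ?exprn_ge0 ?ltW.
    by rewrite ltW.
  by rewrite /r mulrC divfK ?gt_eqF.
(* Submultiplicativity bounds the right side of [aexp] by [a m * a n], and [a m] cancels. *)
have ar m n : r m ^+ n.+1 <= a n.
  rewrite -(ler_pM2l (a0 m)); apply: le_trans (aexp _ _) _.
  by rewrite addnS asub.
(* Otherwise the root [c] of order [n + 1] of [a n] lies below the supremum [mu], so some ratio
   [r m] exceeds it, against [ar]. *)
have amu n : mu ^+ n.+1 <= a n.
  rewrite leNgt; apply/negP => h.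
  pose c := a n `^ (n.+1%:R^-1).
  have cE : c ^+ n.+1 = a n.
    by rewrite /c -powR_mulrn ?powR_ge0// -powRrM mulVf ?pnatr_eq0// powRr1// ltW.
  have c0 : 0 <= c by rewrite powR_ge0.
  have cmu : c < mu by rewrite -(ltr_pXn2r (n := n.+1))// ?nnegrE ?ltW// cE.
  have [_ [m _ <-] cm] := sup_adherent (eps := mu - c) (ltac:(lra)) supS.
  have {}cm : c < r m by move: cm; rewrite -/mu; lra.
  have : c ^+ n.+1 < r m ^+ n.+1 by rewrite ltr_pXn2r ?nnegrE ?c0 ?(ltW (r0 m)).
  by rewrite cE ltNge ar.
pose b n := a n / mu ^+ n.+1.
have mun n : 0 < mu ^+ n by rewrite exprn_gt0.
have bS n : b n.+1 <= b n.
  rewrite /b ler_pdivrMr// [mu ^+ n.+2]exprSr mulrA divfK ?gt_eqF//.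
  by rewrite mulrC -ler_pdivrMr//; exact: rmu.
have ble m n : (m <= n)%N -> b n <= b m.
  elim: n => [|n ih]; first by rewrite leqn0 => /eqP ->.
  by rewrite leq_eqVlt => /predU1P[->//|/ih h]; exact: le_trans (bS n) h.
have b1 n : 1 <= b n by rewrite /b ler_pdivlMr// mul1r.
have infB : has_inf (range b).
  by split; [exists (b 0%N), 0%N|exists 1 => _ [n _ <-]].
exists mu, (inf (range b)); split => //.
- by apply: lb_le_inf => [|_ [n _ <-]]//; exists (b 0%N), 0%N.
- by move=> n; apply: ge_inf; [case: infB|exists n].
- move=> eps eps0; have [_ [N _ <-] hN] := inf_adherent eps0 infB.
  by exists N => n /ble h; exact: le_trans h (ltW hN).
Qed.

End RealSeq.

Section RealEmbedding.
Variables (R : realType) (C : numClosedFieldType).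

(* Says that [C] is [R[i]] without fixing its construction, so that unification
   never unfolds complex arithmetic. *)
Definition real_embedding (toC : {rmorphism R -> C}) :=
  {mono toC : x y / x <= y} /\ forall z : C, z \is Num.real -> exists r, z = toC r.

Variable toC : {rmorphism R -> C}.
Hypothesis hC : real_embedding toC.

Lemma toC_le x y : (toC x <= toC y) = (x <= y).
Proof. by case: hC => ->. Qed.
Lemma toC_lt x y : (toC x < toC y) = (x < y).
Proof. by case: hC => h _; exact: (leW_mono h). Qed.
Lemma toC_ge0 x : (0 <= toC x) = (0 <= x).
Proof. by rewrite -(rmorph0 toC) toC_le. Qed.
Lemma toC_gt0 x : (0 < toC x) = (0 < x).
Proof. by rewrite -(rmorph0 toC) toC_lt. Qed.
Lemma toC_norm x : `|toC x| = toC `|x|.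
Proof.
have [x0|x0] := leP 0 x; first by rewrite !ger0_norm// toC_ge0.
by rewrite !ltr0_norm ?rmorphN// -(rmorph0 toC) toC_lt.
Qed.
Lemma toC_ge0P (z : C) : 0 <= z -> exists2 r, 0 <= r & z = toC r.
Proof.
case: hC => _ h z0; have [r rE] := h _ (ger0_real z0).
by exists r => //; rewrite -toC_ge0 -rE.
Qed.
Lemma toC_gt0P (z : C) : 0 < z -> exists2 r, 0 < r & z = toC r.
Proof.
case: hC => _ h z0; have [r rE] := h _ (gtr0_real z0).
by exists r => //; rewrite -toC_gt0 -rE.
Qed.

Lemma unif_cauchy_lim (T : Type) (s : nat -> T -> C) :
  (forall e : C, 0 < e -> exists N, forall m n, (N <= m)%N -> (N <= n)%N ->
     forall x, `|s m x - s n x| <= e) ->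
  exists f : T -> C, forall e : C, 0 < e -> exists N, forall n, (N <= n)%N ->
    forall x, `|f x - s n x| <= e.
Proof.
move=> cs.
have [f hf] : exists f : T -> C, forall x (e : C), 0 < e ->
    exists N, forall n, (N <= n)%N -> `|f x - s n x| <= e.
  suff /choice[f hf] : forall x, exists l : C, forall e : C, 0 < e ->
    exists N, forall n, (N <= n)%N -> `|l - s n x| <= e by exists f.
  move=> x.
  (* [p] stands for the real part and for the imaginary part. *)
  have part (p : C -> C) : (forall a b, p (a - b) = p a - p b) ->
      (forall a, p a \is Num.real) -> (forall a, `|p a| <= `|a|) ->
      exists l : R, forall e : C, 0 < e ->
    exists N, forall n, (N <= n)%N -> `|toC l - p (s n x)| <= e.
    move=> pB pr pn.
    have /choice[u hu] n : exists r, p (s n x) = toC r by case: hC => _; exact.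
    have [|l hl] := @real_cauchy_lim _ u.
      move=> e; rewrite -toC_gt0 => /cs[N hN]; exists N => m n Nm Nn.
      rewrite -toC_le -toC_norm rmorphB -!hu -pB.
      exact: le_trans (pn _) (hN _ _ Nm Nn x).
    exists l => _ /toC_gt0P[e /hl[N hN] ->]; exists N => n /hN.
    by rewrite -toC_le -toC_norm rmorphB -hu.
  have nRe z : `|'Re z : C| <= `|z| := (leif_normC_Re_Creal z).1.
  have nIm z : `|'Im z : C| <= `|z|.
    by have := nRe ('i * z); rewrite ReMil normrN normrM normCi mul1r.
  have [l1 h1] := part (fun z => 'Re z) (fun a b => raddfB _ a b) (@Creal_Re _) nRe.
  have [l2 h2] := part (fun z => 'Im z) (fun a b => raddfB _ a b) (@Creal_Im _) nIm.
  exists (toC l1 + 'i * toC l2) => e e0.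
  have e2 : 0 < e / 2 by rewrite divr_gt0// ltr0n.
  have [N1 {}h1] := h1 _ e2; have [N2 {}h2] := h2 _ e2.
  exists (maxn N1 N2) => n; rewrite geq_max => /andP[/h1 {}h1 /h2 {}h2].
  rewrite [s n x]Crect (_ : _ - _ = (toC l1 - 'Re (s n x)) + 'i * (toC l2 - 'Im (s n x))); last by ring.
  apply: le_trans (ler_normD _ _) _; rewrite normrM normCi mul1r.
  by rewrite (splitr e) lerD.
exists f => e e0; have e2 : 0 < e / 2 by rewrite divr_gt0// ltr0n.
have [N hN] := cs _ e2; exists N => n Nn x.
have [M hM] := hf x _ e2.
rewrite (_ : _ - _ = (f x - s (maxn N M) x) + (s (maxn N M) x - s n x)); last by ring.
apply: le_trans (ler_normD _ _) _; rewrite (splitr e) lerD//.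
  by rewrite hM// leq_maxr.
by rewrite hN// leq_maxl.
Qed.

End RealEmbedding.

(** * The convolution algebra *)

Section Conv.
Variables (C : numClosedFieldType) (G : topologicalType).
Variables (mul : G -> G -> G) (inv : G -> G) (e : G) (I : (G -> C) -> C).

Definition haar_setting :=
  [/\ is_group mul inv e, continuous (fun p : G * G => mul p.1 p.2), continuous inv,
      compact [set: G] & bumps C G] /\
  (mean I /\ forall h f, contf f -> I (fun x => f (mul h x)) = I f).

Definition gconv (f g : G -> C) : G -> C := fun x => I (fun y => f y * g (mul (inv y) x)).
Definition gstar (f : G -> C) : G -> C := fun x => (f (inv x))^*.

Hypothesis hG : haar_setting.
Local Notation "f ** g" := (gconv f g) (at level 40, left associativity).
Implicit Types f g h : G -> C.

Let gG : is_group mul inv e. Proof. by case: hG => -[]. Qed.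
Let cmul : continuous (fun p : G * G => mul p.1 p.2). Proof. by case: hG => -[]. Qed.
Let cinv : continuous inv. Proof. by case: hG => -[]. Qed.
Let cG : compact [set: G]. Proof. by case: hG => -[]. Qed.
Let bG : bumps C G. Proof. by case: hG => -[]. Qed.
Let mI : mean I. Proof. by case: hG => _ []. Qed.

Lemma haarl (h : G) f : contf f -> I (fun x => f (mul h x)) = I f.
Proof. by case: hG => _ [] _; exact. Qed.
Lemma haarV f : contf f -> I (fun x => f (inv x)) = I f.
Proof.
move=> cf; apply: (haar_inv gG cmul cinv cG bG (H := setT) mI) => //.
- by move=> f1 f2 _ _ h; congr I; apply/funext => x; exact: h.
- by move=> z f1 _; exact: haarl.
Qed.
Lemma haarr (h : G) f : contf f -> I (fun x => f (mul x h)) = I f.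
Proof.
move=> cf; apply: (haar_mulr gG cmul cinv cG bG (H := setT) mI) => //.
- by move=> f1 f2 _ _ h'; congr I; apply/funext => x; exact: h'.
- by move=> h' f1 _; exact: haarl.
Qed.

Let ctr x f : contf f -> contf (fun y => f (mul (inv y) x)).
Proof.
by move=> cf; apply: (contf_mul cmul) cf => y; [exact: cinv|exact: cvg_cst].
Qed.
Arguments ctr x [f] _.

Lemma contf_star f : contf f -> contf (gstar f).
Proof. by move=> cf; apply: contf_conj; exact: (contf_comp cinv cf). Qed.

Lemma contf_conv f g : contf f -> contf g -> contf (f ** g).
Proof.
move=> cf cg.
pose H (p : G * G) : C := f p.2 * g (mul (inv p.2) p.1).
suff cH : contf H by exact: (mean_cont mI cG cH).
apply: contfM; first by apply: (contf_comp _ cf) => p; exact: cvg_snd.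
apply: (contf_mul cmul) cg => p; last exact: cvg_fst.
by apply: (continuous_comp (f := snd)); [exact: cvg_snd|exact: cinv].
Qed.

Lemma starK f : gstar (gstar f) = f.
Proof. by apply/funext => x; rewrite /gstar conjCK (ginvK gG). Qed.

Lemma gconvDl f g h : contf f -> contf g -> contf h ->
  (fun x => f x + g x) ** h = fun x => (f ** h) x + (g ** h) x.
Proof.
move=> cf cg ch; apply/funext => x; have chx := ctr x ch.
rewrite /gconv -meanD//; try by cont.
by congr I; apply/funext => y; rewrite mulrDl.
Qed.

Lemma gconvBl f g h : contf f -> contf g -> contf h ->
  (fun x => f x - g x) ** h = fun x => (f ** h) x - (g ** h) x.
Proof.
move=> cf cg ch; apply/funext => x; have chx := ctr x ch.
rewrite /gconv -meanB//; try by cont.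
by congr I; apply/funext => y; rewrite mulrBl.
Qed.

Lemma gconvZl c f h : contf f -> contf h ->
  (fun x => c * f x) ** h = fun x => c * (f ** h) x.
Proof.
move=> cf ch; apply/funext => x; have chx := ctr x ch.
rewrite /gconv -meanZ//; try by cont.
by congr I; apply/funext => y; rewrite mulrA.
Qed.

Lemma gconvDr f g h : contf f -> contf g -> contf h ->
  h ** (fun x => f x + g x) = fun x => (h ** f) x + (h ** g) x.
Proof.
move=> cf cg ch; apply/funext => x; have cfx := ctr x cf; have cgx := ctr x cg.
rewrite /gconv -meanD//; try by cont.
by congr I; apply/funext => y; rewrite mulrDr.
Qed.

Lemma gconvBr f g h : contf f -> contf g -> contf h ->
  h ** (fun x => f x - g x) = fun x => (h ** f) x - (h ** g) x.
Proof.
move=> cf cg ch; apply/funext => x; have cfx := ctr x cf; have cgx := ctr x cg.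
rewrite /gconv -meanB//; try by cont.
by congr I; apply/funext => y; rewrite mulrBr.
Qed.

Lemma gconvZr c f h : contf f -> contf h ->
  h ** (fun x => c * f x) = fun x => c * (h ** f) x.
Proof.
move=> cf ch; apply/funext => x; have cfx := ctr x cf.
rewrite /gconv -meanZ//; try by cont.
by congr I; apply/funext => y; rewrite mulrCA.
Qed.

(** Fubini, followed by the substitution of [z y] for [y] in the inner mean. *)
Lemma gconvA f g h : contf f -> contf g -> contf h -> (f ** g) ** h = f ** (g ** h).
Proof.
move=> cf cg ch; apply/funext => x.
pose H (p : G * G) : C := f p.2 * g (mul (inv p.2) p.1) * h (mul (inv p.1) x).
have ci1 : continuous (fun p : G * G => inv p.1).
  by move=> p; apply: (continuous_comp (f := fst)); [exact: cvg_fst|exact: cinv].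
have ci2 : continuous (fun p : G * G => inv p.2).
  by move=> p; apply: (continuous_comp (f := snd)); [exact: cvg_snd|exact: cinv].
have cH : contf H.
  apply: contfM; first apply: contfM.
  - by apply: (contf_comp _ cf) => p; exact: cvg_snd.
  - by apply: (contf_mul cmul) cg => p; [exact: ci2|exact: cvg_fst].
  - by apply: (contf_mul cmul) ch => p; [exact: ci1|exact: cvg_cst].
transitivity (I (fun y => I (fun z => H (y, z)))).
  congr I; apply/funext => y; have cgy := ctr y cg.
  by rewrite -meanZr//; cont.
rewrite (fubini cG bG mI mI cH); congr I; apply/funext => z.
have cgz : contf (fun y => g (mul (inv z) y)) by exact: (contf_mulr cmul).
have chx := ctr x ch.
rewrite -(meanZ mI); last first.
  by have ch' := ctr (mul (inv z) x) ch; cont.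
rewrite -(haarl z (f := fun y => H (y, z))); last first.
  by rewrite /H /=; cont.
congr I; apply/funext => y; rewrite /H /= (gmulVK gG) (ginvM gG) mulrA.
by case: gG => a _ _ _ _; rewrite a.
Qed.

Lemma star_conv f g : contf f -> contf g -> gstar (f ** g) = gstar g ** gstar f.
Proof.
move=> cf cg; apply/funext => x; rewrite /gstar /gconv.
have cgx := ctr (inv x) cg.
rewrite -mean_conj//; last by cont.
rewrite -(haarl x (f := fun y => (g (inv y))^* * _)); last first.
  have cg' := contf_star cg; have cf' := contf_star cf.
  have cfx := ctr x cf'; apply: contfM; [exact: cg'|exact: cfx].
congr I; apply/funext => y.
by rewrite conjE !(ginvM gG) !(ginvK gG) mulrC (gmulVK gG).
Qed.

Lemma star_eqB f g : gstar f = f -> gstar g = g ->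
  gstar (fun x => f x - g x) = fun x => f x - g x.
Proof.
move=> /funeqP sf /funeqP sg.
by apply/funext => x; have := sf x; have := sg x; rewrite /gstar !conjE => -> ->.
Qed.

Lemma star_eqZ c f : c^* = c -> gstar f = f -> gstar (fun x => c * f x) = fun x => c * f x.
Proof. move=> sc /funeqP sf.
by apply/funext => x; have := sf x; rewrite /gstar !conjE sc => ->. Qed.

(** Through this identity the norms of convolution powers are values of higher powers at [e]. *)
Lemma gconv_star_e f g : (f ** gstar g) e = ip I f g.
Proof.
case: gG => _ _ r _ _; congr I; apply/funext => y.
by rewrite /gstar r (ginvK gG).
Qed.

Lemma ip_eq0 f : contf f -> ip I f f = 0 -> forall x, f x = 0.
Proof.
move=> cf h x.
have : f x * (f x)^* = 0.
  apply: (haar_eq0 gG cmul cG mI haarl (f := fun x => f x * (f x)^*)) => //; first by cont.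
  by move=> y; exact: mul_conjC_ge0.
by move/eqP; rewrite mulf_eq0 conjC_eq0 orbb => /eqP.
Qed.

(** Cauchy-Schwarz against a reflected translate of [g], which has the norm of [g] because [I] is
    invariant on both sides and under inversion. This is what turns L2 bounds into uniform ones. *)
Lemma gconv_norm_le f g x : contf f -> contf g ->
  `|(f ** g) x| ^+ 2 <= ip I f f * ip I g g.
Proof.
move=> cf cg.
pose h y := (g (mul (inv y) x))^*.
have ch : contf h by apply: contf_conj; exact: ctr.
have -> : (f ** g) x = ip I f h.
  by congr I; apply/funext => y; rewrite /h conjCK.
have -> : ip I g g = ip I h h; last exact: cauchy_schwarz.
pose k y := g y * (g y)^*.
have ck : contf k by rewrite /k; cont.
rewrite /ip -/k -(haarr x ck) -haarV; last exact: (contf_mull cmul).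
by congr I; apply/funext => y; rewrite /h /k conjCK mulrC.
Qed.

Lemma ip_conv_le f g : contf f -> contf g ->
  ip I (f ** g) (f ** g) <= ip I f f * ip I g g.
Proof.
move=> cf cg; have cfg := contf_conv cf cg.
by apply: ip_le => // x; exact: gconv_norm_le.
Qed.

Lemma ip_star f g : contf f -> contf g -> gstar f = f -> gstar g = g ->
  ip I f g = (f ** g) e.
Proof. by move=> cf cg sf sg; rewrite -gconv_star_e sg. Qed.

End Conv.

(** * Idempotents as limits of convolution powers *)

Section Idempotent.
Variables (R : realType) (C : numClosedFieldType) (G : topologicalType).
Variables (mul : G -> G -> G) (inv : G -> G) (e : G) (I : (G -> C) -> C).
Variable toC : {rmorphism R -> C}.
Hypotheses (hC : real_embedding toC) (hG : haar_setting mul inv e I).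
Local Notation "f ** g" := (gconv mul inv I f g) (at level 40, left associativity).
Local Notation star := (gstar inv).
Implicit Types f g h : G -> C.

Let mI : mean I. Proof. by case: hG => _ []. Qed.

Lemma gconv_unifl f f' g (d : C) x : contf f -> contf f' -> contf g -> 0 <= d ->
  (forall y, `|f y - f' y| <= d) ->
  `|(f ** g) x - (f' ** g) x| <= d * sqrtC (ip I g g).
Proof.
move=> cf cf' cg d0 hd.
rewrite -(@ler_pXn2r _ 2) ?nnegrE ?mulr_ge0 ?sqrtC_ge0 ?ip_ge0//.
rewrite exprMn sqrtCK.
have cff : contf (fun y => f y - f' y) by cont.
have -> : (f ** g) x - (f' ** g) x = ((fun y => f y - f' y) ** g) x.
  by rewrite (gconvBl hG).
apply: le_trans (gconv_norm_le hG x cff cg) _.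
rewrite ler_wpM2r ?ip_ge0//.
by apply: ip_le => // y; rewrite ler_pXn2r ?nnegrE.
Qed.

Lemma gconv_unifr f f' g (d : C) x : contf f -> contf f' -> contf g -> 0 <= d ->
  (forall y, `|f y - f' y| <= d) ->
  `|(g ** f) x - (g ** f') x| <= d * sqrtC (ip I g g).
Proof.
move=> cf cf' cg d0 hd.
rewrite -(@ler_pXn2r _ 2) ?nnegrE ?mulr_ge0 ?sqrtC_ge0 ?ip_ge0//.
rewrite exprMn sqrtCK.
have cff : contf (fun y => f y - f' y) by cont.
have -> : (g ** f) x - (g ** f') x = (g ** (fun y => f y - f' y)) x.
  by rewrite (gconvBr hG).
apply: le_trans (gconv_norm_le hG x cg cff) _.
rewrite mulrC ler_wpM2r ?ip_ge0//.
by apply: ip_le => // y; rewrite ler_pXn2r ?nnegrE.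
Qed.

(* The squared L2 norms of the convolution powers of [k] grow like [mu ^+ n];
   the normalized powers of [k ** k] converge uniformly to the projection onto
   the top eigenspace of convolution by [k ** k]. *)
Lemma idempotent_limit k x0 : contf k -> star k = k -> k x0 != 0 ->
  exists p (mu : C), [/\ 0 < mu, contf p, star p = p, p ** p = p /\ p e != 0 &
    (k ** k) ** p = fun x => mu * p x].
Proof.
move=> ck sk kx0.
(* [pw n] has exponent [n + 1], whence the successor in [pwM]. *)
pose pw := fix pw n := if n is n'.+1 then k ** pw n' else k.
have cpw n : contf (pw n) by elim: n => [|n ih] //=; exact: (contf_conv hG).
have pwM m n : pw m ** pw n = pw (m + n).+1.
  by elim: m => [|m ih] //=; rewrite (gconvA hG)// ih.
have spw n : star (pw n) = pw n.
  by elim: n => [|n ih] //=; rewrite (star_conv hG)// ih sk (pwM n 0%N) addn0.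
have ipw m n : ip I (pw m) (pw n) = pw (m + n).+1 e.
  by rewrite (ip_star hG)// pwM.
pose A n := ip I (pw n) (pw n).
have A0 n : 0 <= A n by exact: ip_ge0.
(* By [ipw] the inner product of two powers depends only on the sum of their exponents, so
   Cauchy-Schwarz is log-convexity. *)
have Acv n : A n.+1 ^+ 2 <= A n * A n.+2.
  have := cauchy_schwarz mI (cpw n) (cpw n.+2).
  rewrite (_ : ip I (pw n) (pw n.+2) = A n.+1); last first.
    by rewrite /A !ipw addnS addSn addnS.
  by rewrite ger0_norm.
have Asub m n : A (m + n).+1 <= A m * A n.
  by rewrite /A -pwM; exact: (ip_conv_le hG).
have k1 f : contf f -> ip I f f != 0 -> forall g, contf g -> g e = ip I f f -> ip I g g != 0.
  move=> cf f0 g cg ge; apply/eqP => /(ip_eq0 hG cg)/(_ e).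
  by rewrite ge => /eqP; rewrite (negbTE f0).
have A00 : A 0%N != 0.
  by apply/eqP => /(ip_eq0 hG ck)/(_ x0)/eqP; rewrite (negbTE kx0).
have Apos n : 0 < A n.
  rewrite lt0r A0 andbT.
  suff : A n != 0 /\ A n.+1 != 0 by case.
  elim: n => [|n [ih1 ih2]]; split => //.
    by apply: (k1 _ (cpw 0%N) A00 (pw 1%N)) => //; rewrite ipw.
  apply/eqP => A2; have := Acv n; rewrite A2 mulr0 => h.
  have : A n.+1 ^+ 2 == 0 by rewrite eq_le h exprn_ge0.
  by rewrite expf_eq0 /= (negbTE ih2).
have /choice[a ha] n : exists r, A n = toC r by have [r _ ->] := toC_ge0P hC (A0 n); exists r.
have [|||mu [bt [mu0 bt1 hb1 hb2]]] := @growth_rate R a.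
- by move=> n; rewrite -(toC_gt0 hC) -ha.
- by move=> n; rewrite -(toC_le hC) rmorphXn rmorphM -!ha /=.
- by move=> m n; rewrite -(toC_le hC) rmorphM -!ha.
pose M := toC mu; have M0 : 0 < M by rewrite toC_gt0.
have Mr := ge0_conjC (ltW M0).
pose c n : C := (M ^+ n.+1)^-1.
have c0 n : 0 < c n by rewrite invr_gt0 exprn_gt0.
have cr n : (c n)^* = c n by apply: ge0_conjC; exact: ltW.
have cM m n : c m * c n = c (m + n).+1.
  by rewrite /c -invfM -exprD; congr (_ ^+ _)^-1; lia.
(* The exponent here is [2 (n + 1)]: [q n] is the power of order [n + 1] of [k ** k], divided by
   [M ^ (n + 1)]. *)
pose q n : G -> C := fun x => c n * pw (n + n).+1 x.
have cq n : contf (q n) by apply: contfM => //; exact: contf_cst.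
pose b n := a n / mu ^+ n.+1.
have bE n : toC (b n) = c n * A n.
  by rewrite /b rmorphM fmorphV rmorphXn -ha mulrC.
have ipq m n : ip I (q m) (q n) = toC (b (m + n).+1).
  rewrite bE -cM; transitivity (c m * c n * ip I (pw (m + m).+1) (pw (n + n).+1)).
    have cm := cpw (m + m).+1; have cn := cpw (n + n).+1.
    rewrite /ip -meanZ//; last by cont.
    by congr I; apply/funext => x; rewrite /q conjE cr; ring.
  by congr (_ * _); rewrite /A !ipw; congr (pw _ e); lia.
(* The three terms tend to the same limit [bt], so [q] is Cauchy in the L2 norm. *)
have qD m n : ip I (fun x => q m x - q n x) (fun x => q m x - q n x) =
    toC (b (m + m).+1 + b (n + n).+1 - 2 * b (m + n).+1).
  have -> : (fun x => q m x - q n x) = (fun x => q m x - 1 * q n x).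
    by apply/funext => x; rewrite mul1r.
  rewrite (ip_subZ mI 1)// !ipq conjC1 ge0_conjC; last first.
    by rewrite bE mulr_ge0// ltW.
  by rewrite mulr_natl rmorphB rmorphD rmorphMn -mulr_natl /=; ring.
have kk : k ** k = pw 1%N by [].
have kq n : pw 1%N ** q n = fun x => M * q n.+1 x.
  rewrite (gconvZr hG)// pwM; apply/funext => x.
  have -> : c n = M * c n.+1.
    by rewrite /c [M ^+ n.+2]exprS invfM mulrA divff ?gt_eqF// mul1r.
  by rewrite /q -mulrA; congr (_ * (_ * pw _ x)); lia.
pose S := ip I (pw 1%N) (pw 1%N).
have S0 : 0 <= S by exact: ip_ge0.
have [p hp] : exists p : G -> C, forall d : C, 0 < d -> exists N, forall n, (N <= n)%N ->
    forall x, `|p x - q n x| <= d.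
  apply: (unif_cauchy_lim hC) => d d0.
  (* Chosen so that [S * (2 eps) <= (d M) ^ 2]; the 1 in [S + 1] avoids a case distinction on
     [S]. *)
  have : 0 < d ^+ 2 * M ^+ 2 / (2 * (S + 1)).
    by rewrite divr_gt0 ?mulr_gt0 ?exprn_gt0 ?ltr0n ?ltr_wpDl.
  move=> /(toC_gt0P hC)[eps eps0 epsE].
  (* Positive indices are needed: [M * q m.+1] is the convolution of [k ** k] with [q m], and this
     extra convolution makes the L2 estimate uniform. *)
  have [N hN] := hb2 _ eps0; exists N.+1 => -[//|m] [//|n] Nm Nn x.
  have cmn : contf (fun x => q m x - q n x) by exact: contfB (cq m) (cq n).
  rewrite -(@ler_pXn2r _ 2) ?nnegrE ?(ltW d0)//.
  rewrite -(ler_pM2l (exprn_gt0 2 M0)).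
  rewrite -[X in X * `|_| ^+ 2 <= _](ger0_norm (exprn_ge0 2 (ltW M0))) normrX -exprMn -normrM.
  rewrite mulrBr -!(fun n => congr1 (fun f => f x) (kq n)).
  have -> : (pw 1%N ** q m) x - (pw 1%N ** q n) x = (pw 1%N ** (fun x => q m x - q n x)) x.
    by rewrite (gconvBr hG).
  apply: le_trans (gconv_norm_le hG x (cpw 1%N) cmn) _.
  apply: le_trans (_ : _ <= S * toC (2 * eps)) _.
    apply: ler_wpM2l => //; rewrite qD (toC_le hC).
    have := hN (m + m).+1 (ltac:(lia)); have := hN (n + n).+1 (ltac:(lia)).
    have := hb1 (m + n).+1; rewrite /b; lra.
  rewrite mulr_natl rmorphMn -epsE -mulr_natl mulrC.
  rewrite (_ : _ * S = d ^+ 2 * M ^+ 2 * (S / (S + 1))); last first.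
    by field; rewrite gt_eqF// ltr_wpDl.
  rewrite [leRHS]mulrC -[leRHS]mulr1 ler_wpM2l ?mulr_ge0 ?exprn_ge0 ?(ltW d0) ?(ltW M0)//.
  by rewrite ler_pdivrMr ?ltr_wpDl// mul1r lerDl.
have cp : contf p.
  by apply: (contf_unif_lim cq) => d d0; have [N hN] := hp _ d0; exists N; exact: hN.
have pe : 1 <= p e.
  rewrite -subr_ge0; apply: (@ge0_of_close _ _ 1) => d d0.
  have [N hN] := hp _ d0; exists (q N e - 1); last first.
    by rewrite opprB addrA subrK mul1r hN.
  have -> : q N e = toC (b N) by rewrite bE /A ipw.
  rewrite subr_ge0 -(rmorph1 toC) (toC_le hC); exact: le_trans bt1 (hb1 _).
exists p, M; split => //.
- apply/funext => x; apply: (@eq_of_close _ _ _ 2) => d d0.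
  have [N hN] := hp _ d0.
  have h1 := hN _ (leqnn _) (inv x); have h2 := hN _ (leqnn _) x.
  have qx : (q N (inv x))^* = q N x.
    by rewrite /q conjE cr; congr (_ * _); have /funeqP := spw (N + N).+1; exact.
  rewrite /gstar (_ : _ - _ = (p (inv x) - q N (inv x))^* - (p x - q N x)); last first.
    by rewrite -qx; set z := q N (inv x); rewrite conjE; ring.
  by rewrite (le_trans (ler_normB _ _))// norm_conjC mulr_natl mulr2n lerD.
- split; last by rewrite gt_eqF// (lt_le_trans ltr01).
  have [B hB] : exists B, forall n, (B <= n)%N -> ip I (q n) (q n) <= toC (bt + 1).
    have [N hN] := hb2 1 ltr01; exists N => n Nn.
    by rewrite ipq (toC_le hC) /b hN//; lia.
  apply/funext => x.
  apply: (@eq_of_close _ _ _ (sqrtC (ip I p p) + sqrtC (toC (bt + 1)) + 1)) => d d0.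
  have [N hN] := hp _ d0; pose n := maxn N B.
  have h1 := hN n (leq_maxl _ _); have h2 := hN (n + n).+1 (ltac:(lia)) x.
  (* The sequence is stable under squaring, so [p ** p] and [p] are limits of the same functions. *)
  have qq : q n ** q n = q (n + n).+1.
    rewrite (gconvZl hG)// (gconvZr hG)// pwM; apply/funext => y.
    by rewrite mulrA cM /q; congr (_ * pw _ _); lia.
  have h3 := gconv_unifl x cp (cq n) cp (ltW d0) h1.
  have h4 := gconv_unifr x cp (cq n) (cq n) (ltW d0) h1.
  rewrite (_ : _ - _ = ((p ** p) x - (q n ** p) x) + ((q n ** p) x - (q n ** q n) x)
     - (p x - q (n + n).+1 x)); last by rewrite qq; ring.
  apply: le_trans (ler_normB _ _) _; rewrite !mulrDl mul1r lerD//.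
  apply: le_trans (ler_normD _ _) _; rewrite lerD// ?[_ * d]mulrC//.
  apply: le_trans h4 _; rewrite ler_wpM2l ?(ltW d0)//.
  by rewrite ler_sqrtC ?nnegrE ?ip_ge0 ?hB ?leq_maxr// (toC_ge0 hC) addr_ge0// (le_trans ler01).
- rewrite kk; apply/funext => x.
  apply: (@eq_of_close _ _ _ (sqrtC S + M)) => d d0.
  have [N hN] := hp _ d0.
  have h1 := hN N (leqnn _); have h2 := hN N.+1 (leqnSn _) x.
  have h3 := gconv_unifr x cp (cq N) (cpw 1%N) (ltW d0) h1.
  rewrite (_ : _ - _ = ((pw 1%N ** p) x - (pw 1%N ** q N) x) - M * (p x - q N.+1 x)); last first.
    by rewrite kq; ring.
  apply: le_trans (ler_normB _ _) _; rewrite mulrDl lerD//; first by rewrite mulrC.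
  by rewrite normrM gtr0_norm// ler_wpM2l// ltW.
Qed.

End Idempotent.

(** * Bi-invariant functions and minimal idempotents *)

Section Spherical.
Variables (R : realType) (C : numClosedFieldType) (G : topologicalType).
Variables (mul : G -> G -> G) (inv : G -> G) (e : G) (I : (G -> C) -> C).
Variables (K : set G) (J : (G -> C) -> C).
Implicit Types f g h p : G -> C.
Local Notation "f ** g" := (gconv mul inv I f g) (at level 40, left associativity).
Local Notation star := (gstar inv).

Definition biK f := (forall k x, K k -> f (mul k x) = f x) /\
  (forall k x, K k -> f (mul x k) = f x).

Definition gelfand_setting :=
  [/\ haar_setting mul inv e I,
      is_subgroup mul inv e K,
      mean J /\ (forall (h : G) f, K h -> contf f -> J (fun x => f (mul h x)) = J f),
      (forall f g, contf f -> contf g -> (forall x, K x -> f x = g x) -> J f = J g) &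
      forall f g, contf f -> contf g -> biK f -> biK g -> f ** g = g ** f].

Definition spherical_pd f :=
  [/\ contf f, f e = 1, forall x y, J (fun k => f (mul (mul x k) y)) = f x * f y &
      posdef mul inv f].

Variable toC : {rmorphism R -> C}.
Hypotheses (hC : real_embedding toC) (hS : gelfand_setting).

Let hG : haar_setting mul inv e I. Proof. by case: hS. Qed.
Let mI : mean I. Proof. by case: hG => _ []. Qed.
Let gG : is_group mul inv e. Proof. by case: hG => -[]. Qed.
Let cmul : continuous (fun p : G * G => mul p.1 p.2). Proof. by case: hG => -[]. Qed.
Let cinv : continuous inv. Proof. by case: hG => -[]. Qed.
Let cG : compact [set: G]. Proof. by case: hG => -[]. Qed.
Let bG : bumps C G. Proof. by case: hG => -[]. Qed.
Let mJ : mean J. Proof. by case: hS => _ _ []. Qed.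
Let KV x : K x -> K (inv x). Proof. by case: hS => _ [_ _ h] _ _ _; exact: h. Qed.
Let mulA x y z : mul x (mul y z) = mul (mul x y) z.
Proof. by case: gG => a _ _ _ _; exact: a. Qed.
Let mule x : mul x e = x. Proof. by case: gG. Qed.
Let emul x : mul e x = x. Proof. by case: gG. Qed.

Lemma gconvC f g : contf f -> contf g -> biK f -> biK g -> f ** g = g ** f.
Proof. by case: hS => _ _ _ _; exact. Qed.

Lemma meanK_l (k : G) f : K k -> contf f -> J (fun x => f (mul k x)) = J f.
Proof. by case: hS => _ _ [_ h] _ _; exact: h. Qed.

Lemma meanK_r (k : G) f : K k -> contf f -> J (fun x => f (mul x k)) = J f.
Proof.
move=> Kk cf; apply: (haar_mulr gG cmul cinv cG bG (H := K) mJ) => //.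
- by case: hS.
- by move=> z f1 Kz; exact: meanK_l.
Qed.

Lemma meanK_eq f c : contf f -> (forall k, K k -> f k = c) -> J f = c.
Proof.
move=> cf fc; rewrite -[RHS](mean_cst mJ); case: hS => _ _ _ supp _.
by apply: supp => //; exact: contf_cst.
Qed.

Lemma biK_conv f g : contf f -> contf g -> biK f -> biK g -> biK (f ** g).
Proof.
move=> cf cg [fl _] [_ gr]; split=> k x Kk; last first.
  by congr I; apply/funext => y; rewrite mulA gr.
rewrite /gconv -(haarl hG k (f := fun y => f y * _)); last first.
  apply: contfM => //; apply: (contf_mul cmul) cg => y; [exact: cinv|exact: cvg_cst].
congr I; apply/funext => y.
by rewrite fl// (ginvM gG) -mulA (gmulVK gG).
Qed.

Lemma biK_star f : biK f -> biK (star f).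
Proof.
by move=> [fl fr]; split=> k x /KV Kk; rewrite /gstar (ginvM gG) ?(fl _ _ Kk) ?(fr _ _ Kk).
Qed.

Lemma biKD f g : biK f -> biK g -> biK (fun x => f x + g x).
Proof.
move=> [fl fr] [gl gr]; split=> k x Kk;
  by rewrite ?(fl _ _ Kk) ?(gl _ _ Kk) ?(fr _ _ Kk) ?(gr _ _ Kk).
Qed.

Lemma biKB f g : biK f -> biK g -> biK (fun x => f x - g x).
Proof.
move=> [fl fr] [gl gr]; split=> k x Kk;
  by rewrite ?(fl _ _ Kk) ?(gl _ _ Kk) ?(fr _ _ Kk) ?(gr _ _ Kk).
Qed.

Lemma biKZ c f : biK f -> biK (fun x => c * f x).
Proof. by move=> [fl fr]; split=> k x Kk; rewrite ?(fl _ _ Kk) ?(fr _ _ Kk). Qed.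

Definition idem p := [/\ contf p, biK p, star p = p & p ** p = p].

Lemma idem_ip p : idem p -> ip I p p = p e.
Proof. by case=> cp _ sp pp; rewrite (ip_star hG)// pp. Qed.

Lemma idem_eq0 p : idem p -> p e = 0 -> p = fun=> 0.
Proof.
move=> ip0 pe; apply/funext => x; apply: (ip_eq0 hG); first by case: ip0.
by rewrite idem_ip.
Qed.

(** [p e] is the squared norm of [p], and it bounds [|p|] everywhere since [p = p ** p]; hence
    [p e <= (p e) ^ 2]. *)
Lemma idem_ge1 p : idem p -> p e != 0 -> 1 <= p e.
Proof.
move=> ip0 pe; have [cp _ sp pp] := ip0.
have p0 : 0 < p e by rewrite lt0r pe -idem_ip// ip_ge0.
have : ip I p p <= p e ^+ 2.
  apply: ip_le => // x; rewrite -{1}pp.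
  by apply: le_trans (gconv_norm_le hG x cp cp) _; rewrite idem_ip.
by rewrite idem_ip// expr2 ler_pMr.
Qed.

Lemma idemB p r : idem p -> idem r -> r ** p = r -> idem (fun x => p x - r x).
Proof.
move=> [cp Ap sp pp] [cr Ar sr rr] rp; split.
- by cont.
- exact: biKB.
- by apply: star_eqB.
- rewrite (gconvBl hG)//; last by cont.
  rewrite !(gconvBr hG)// pp rr rp (gconvC cp cr)// rp.
  by apply/funext => x; ring.
Qed.

Definition minimal p := forall r, idem r -> r ** p = r -> r e = 0 \/ r = p.

(* Nonzero idempotents have value at least 1 at [e] and these values add up
   along orthogonal decompositions, so splitting terminates. *)
Lemma minimal_idem p : idem p -> p e != 0 ->
  exists q, [/\ idem q, q e != 0, q ** p = q & minimal q].
Proof.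
move=> ip0 pe.
have [n hn] : exists n : nat, p e <= n%:R.
  have [r r0 rE] := toC_ge0P hC (le_trans ler01 (idem_ge1 ip0 pe)).
  exists (Num.bound r); rewrite rE -(rmorph_nat toC) (toC_le hC).
  exact: ltW (archi_boundP r0).
elim: n p ip0 pe hn => [|n ih] p ip0 pe hn.
  by have := le_trans (idem_ge1 ip0 pe) hn; rewrite ler10.
have [pm|] := pselect (minimal p).
  by exists p; split => //; case: ip0.
move=> /existsNP[r /not_implyP[ir /not_implyP[rp /not_orP[/eqP re rnp]]]].
have cp : contf p by case: ip0.
have cr : contf r by case: ir.
have ipr := idemB ip0 ir rp.
have pre : p e - r e != 0.
  apply/eqP => h; apply: rnp; apply/funext => x; apply/esym/eqP.
  by rewrite -subr_eq0; have /funeqP/(_ x) -> := idem_eq0 ipr h.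
have [|q [iq qe qr qm]] := ih r ir re.
  rewrite -(lerD2r 1) natr1; apply: le_trans hn.
  by have := idem_ge1 ipr pre; rewrite lerBrDr addrC.
exists q; split => //.
by rewrite -qr (gconvA hG)// ?rp//; case: iq.
Qed.

(** [r] is a multiple of a convolution with [g] on the left, so it inherits left invariance;
    self-adjointness gives right invariance. *)
Lemma idempotent_limit_biK g x0 : contf g -> biK g -> star g = g -> g x0 != 0 ->
  exists r (mu : C), [/\ 0 < mu, idem r, r e != 0 & (g ** g) ** r = fun x => mu * r x].
Proof.
move=> cg Ag sg gx0.
have [r [mu [mu0 cr sr [rr re] gr]]] := idempotent_limit hC hG cg sg gx0.
exists r, mu; split => //.
have cgg := contf_conv hG cg cg.
have rE : r = fun x => mu^-1 * ((g ** g) ** r) x.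
  by apply/funext => x; rewrite gr mulKf// gt_eqF.
have rl k x : K k -> r (mul k x) = r x.
  rewrite rE => Kk; congr (_ * _).
  have [h _] : biK g by [].
  rewrite (gconvA hG)// {1}/gconv.
  rewrite -(haarl hG k (f := fun y => g y * _)); last first.
    apply: contfM => //; apply: (contf_mul cmul) (contf_conv hG cg cr) => y.
      exact: cinv.
    exact: cvg_cst.
  by congr I; apply/funext => y; rewrite h// (ginvM gG) -mulA (gmulVK gG).
have Ar : biK r.
  split=> // k x /KV Kk; move/funeqP: sr => sr.
  by rewrite -sr -[RHS]sr /gstar (ginvM gG) rl.
by [].
Qed.

Section MinimalCharacter.
Variable p : G -> C.
Hypotheses (ip0 : idem p) (mp : minimal p).

Let cp : contf p. Proof. by case: ip0. Qed.
Let Ap : biK p. Proof. by case: ip0. Qed.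
Let sp : star p = p. Proof. by case: ip0. Qed.
Let pp : p ** p = p. Proof. by case: ip0. Qed.

(** The idempotent obtained from the powers of [g] lies below [p] because [g ** p = g]. By
    minimality it is [p], so the eigenvalue relation is one for [p]. *)
Lemma minimal_square g : contf g -> biK g -> star g = g -> g ** p = g ->
  g = (fun=> 0) \/ exists2 mu : C, 0 < mu & g ** g = fun x => mu * p x.
Proof.
move=> cg Ag sg gp.
have [g0|/existsNP[x0 /eqP gx0]] := pselect (forall x, g x = 0).
  by left; apply/funext.
right; have [r [mu [mu0 ir re gr]]] := idempotent_limit_biK cg Ag sg gx0.
have [cr Ar sr rr] := ir.
have cgg := contf_conv hG cg cg.
have rE : r = fun x => mu^-1 * ((g ** g) ** r) x.
  by apply/funext => x; rewrite gr mulKf// gt_eqF.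
have rp : r ** p = r.
  rewrite gconvC// {1}rE (gconvZr hG)//; last exact: (contf_conv hG).
  rewrite -!(gconvA hG)// (gconvC cp cg Ap Ag) gp.
  by rewrite [RHS]rE (gconvA hG).
have [/eqP|rEp] := mp ir rp; first by rewrite (negbTE re).
by exists mu => //; rewrite -rEp -gr rEp (gconvA hG)// gp.
Qed.

(* Factor [g ** g - mu p = (g - s p) ** (g + s p)] with [s ^ 2 = mu]. *)
Lemma minimal_hermitian g : contf g -> biK g -> star g = g -> g ** p = g ->
  exists c : C, g = fun x => c * p x.
Proof.
move=> cg Ag sg gp.
have [->|[mu mu0 gg]] := minimal_square cg Ag sg gp.
  by exists 0; apply/funext => x; rewrite mul0r.
pose s := sqrtC mu.
have s2 : s * s = mu by rewrite -expr2 sqrtCK.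
have sr : s^* = s by apply: ge0_conjC; rewrite sqrtC_ge0 ltW.
pose t x := s * p x.
have ct : contf t by rewrite /t; cont.
have At : biK t by exact: biKZ.
have st : star t = t by exact: star_eqZ.
have tp : t ** p = t by rewrite (gconvZl hG)// pp.
have tt : t ** t = fun x => mu * p x.
  rewrite (gconvZr hG)// tp; apply/funext => x.
  by rewrite mulrA s2.
pose u x := g x - t x; pose v x := g x + t x.
have cu : contf u by rewrite /u; cont.
have cv : contf v by rewrite /v; cont.
have Au : biK u by exact: biKB.
have Av : biK v by exact: biKD.
have su : star u = u by exact: star_eqB.
have up : u ** p = u by rewrite (gconvBl hG)// gp tp.
have vp : v ** p = v by rewrite (gconvDl hG)// gp tp.
have [u0|[nu nu0 uu]] := minimal_square cu Au su up.
  exists s; apply/funext => x; apply/eqP; rewrite -subr_eq0.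
  by move/funeqP: u0 => /(_ x) <-.
have uv : u ** v = fun=> 0.
  rewrite (gconvDr hG)// !(gconvBl hG)// gg tt (gconvC cg ct)//.
  by apply/funext => x; ring.
(* The left side is [nu v], so [v = 0] and [g = - s p]. Zero is written as a multiple to let
   [gconvZr] apply. *)
have : u ** (u ** v) = u ** (fun x => 0 * v x).
  by rewrite uv; congr (_ ** _); apply/funext => x; rewrite mul0r.
rewrite -(gconvA hG)// uu (gconvZl hG)// (gconvZr hG)// (gconvC cp cv)// vp.
move=> /funeqP h; exists (- s); apply/funext => x; apply/eqP.
rewrite mulNr -addr_eq0; have := h x; rewrite mul0r => /eqP.
by rewrite mulf_eq0 gt_eqF.
Qed.

(** Reduces to self-adjoint elements: [g] is a combination of [g + star g] and ['i (g - star g)]. *)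
Lemma minimal_char g : contf g -> biK g -> exists c : C, g ** p = fun x => c * p x.
Proof.
move=> cg Ag.
have herm h : contf h -> biK h -> star h = h -> exists c : C, h ** p = fun x => c * p x.
  move=> ch Ah sh; apply: minimal_hermitian; first exact: (contf_conv hG).
  - exact: biK_conv.
  - by rewrite (star_conv hG)// sp sh gconvC.
  - by rewrite (gconvA hG)// pp.
have cs := contf_star hG cg; have As := biK_star Ag.
have [|||a ha] := herm (fun x => g x + star g x).
- by cont.
- exact: biKD.
- by apply/funext => x; rewrite /gstar !conjE (ginvK gG) addrC.
have [|||b hb] := herm (fun x => 'i * (g x - star g x)).
- by cont.
- by apply: biKZ; exact: biKB.
- by apply/funext => x; rewrite /gstar !conjE (ginvK gG) conjCi; ring.
have ci : contf (fun x => g x - star g x) by cont.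
exists ((a - 'i * b) / 2); apply/funext => x.
have {ha} := congr1 (fun f => f x) ha; have {hb} := congr1 (fun f => f x) hb.
rewrite (gconvZl hG)// (gconvBl hG)// (gconvDl hG)// => h1 h2.
have {}h1 : (g ** p) x - (star g ** p) x = - 'i * (b * p x).
  by rewrite -h1 mulrA mulNr mulCii opprK mul1r.
rewrite (_ : (g ** p) x = (((g ** p) x + (star g ** p) x) +
  ((g ** p) x - (star g ** p) x)) / 2); last by field.
by rewrite h1 h2; field.
Qed.

End MinimalCharacter.

Lemma star_conv_translate f x y : contf f ->
  (star f ** f) (mul (inv x) y) = I (fun z => (f (mul z x))^* * f (mul z y)).
Proof.
move=> cf; have cfx u : contf (fun z => f (mul z u)) by exact: (contf_mull cmul).
rewrite /gconv -(haarl hG (inv x) (f := fun z => _ * f (mul (inv z) _))); last first.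
  apply: contfM; first exact: (contf_star hG).
  by apply: (contf_mul cmul) cf => z; [exact: cinv|exact: cvg_cst].
have h1 := cfx x; have h2 := cfx y.
rewrite -(haarV hG (f := fun z => (f (mul z x))^* * _)); last by cont.
congr I; apply/funext => z; rewrite /gstar !(ginvM gG) !(ginvK gG) -mulA.
by rewrite (gmulKV gG).
Qed.

(* [(star f ** f) (x^-1 y)] is an integral of rank one kernels, hence no appeal
   to Schur's product theorem. *)
Lemma star_conv_posdefM (L : Type) (mulL : L -> L -> L) (invL : L -> L) f (B : L -> C) :
  contf f -> posdef mulL invL B ->
  posdef (fun a b : G * L => (mul a.1 b.1, mulL a.2 b.2))
    (fun a : G * L => (inv a.1, invL a.2)) (fun a => B a.2 * (star f ** f) a.1).
Proof.
move=> cf pB n xs c /=.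
have cfx x : contf (fun z => f (mul z x)) by exact: (contf_mull cmul).
pose b j k := B (mulL (invL (xs j).2) (xs k).2).
pose t j z := (f (mul z (xs j).1))^* * c j.
have ct j : contf (t j) by have := cfx (xs j).1 => h; rewrite /t; cont.
have cjk j k : contf (fun z => b j k * t j z * (t k z)^*).
  by have h1 := ct j; have h2 := ct k; cont.
rewrite (_ : \sum_(j < n) _ =
    I (fun z => \sum_(j < n) \sum_(k < n) b j k * t j z * (t k z)^*)); last first.
  rewrite mean_sum//; last by move=> j; exact: contf_sum.
  apply: eq_bigr => j _; rewrite mean_sum//; apply: eq_bigr => k _.
  have h1 := cfx (xs j).1; have h2 := cfx (xs k).1.
  rewrite star_conv_translate// -mulrA -/(b j k) -mulrA -meanZr//; last by cont.
  rewrite -meanZ//; last by cont.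
  by congr I; apply/funext => z; rewrite /t !conjE; ring.
apply: mean_ge0 => //; last by move=> z; exact: (pB n (fun j => (xs j).2) (fun j => t j z)).
by apply: contf_sum => j; exact: contf_sum.
Qed.

Lemma star_conv_posdef f : contf f -> posdef mul inv (star f ** f).
Proof.
move=> cf n xs c.
(* The one-point group with [B = 1] recovers this case from the product version. *)
have p1 : posdef (fun _ _ => tt) (fun _ => tt) (fun _ : unit => 1 : C).
  move=> m us d; rewrite (_ : \sum_(j < m) _ = (\sum_(j < m) d j) * (\sum_(j < m) d j)^*).
    exact: mul_conjC_ge0.
  rewrite conj_sum mulr_suml; apply: eq_bigr => j _.
  by rewrite mulr_sumr; apply: eq_bigr => k _; rewrite mul1r.
have := star_conv_posdefM cf p1 (fun j : 'I_n => (xs j, tt)) c.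
by under eq_bigr => j _ do under eq_bigr => k _ do rewrite mul1r.
Qed.

End Spherical.

(** * Spherical functions *)

Lemma posdefZ (C : numClosedFieldType) (T : Type) (mul : T -> T -> T) (inv : T -> T)
  (c : C) (f : T -> C) : 0 <= c -> posdef mul inv f -> posdef mul inv (fun x => c * f x).
Proof.
move=> c0 pf n xs d; have := mulr_ge0 c0 (pf n xs d).
rewrite mulr_sumr; congr (0 <= _); apply: eq_bigr => j _.
by rewrite mulr_sumr; apply: eq_bigr => k _; rewrite !mulrA.
Qed.

Section SphericalFunctions.
Variables (R : realType) (C : numClosedFieldType) (G : topologicalType).
Variables (mul : G -> G -> G) (inv : G -> G) (e : G) (I : (G -> C) -> C).
Variables (K : set G) (J : (G -> C) -> C).
Implicit Types f g h p : G -> C.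
Local Notation "f ** g" := (gconv mul inv I f g) (at level 40, left associativity).
Local Notation star := (gstar inv).
Local Notation biK := (biK mul K).
Local Notation spherical_pd := (spherical_pd mul inv e J).

Variable toC : {rmorphism R -> C}.
Hypotheses (hC : real_embedding toC) (hS : gelfand_setting mul inv e I K J).

Let hG : haar_setting mul inv e I. Proof. by case: hS. Qed.
Let mI : mean I. Proof. by case: hG => _ []. Qed.
Let gG : is_group mul inv e. Proof. by case: hG => -[]. Qed.
Let cmul : continuous (fun p : G * G => mul p.1 p.2). Proof. by case: hG => -[]. Qed.
Let cinv : continuous inv. Proof. by case: hG => -[]. Qed.
Let cG : compact [set: G]. Proof. by case: hG => -[]. Qed.
Let bG : bumps C G. Proof. by case: hG => -[]. Qed.
Let mJ : mean J. Proof. by case: hS => _ _ []. Qed.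
Let KV x : K x -> K (inv x). Proof. by case: hS => _ [_ _ h] _ _ _; exact: h. Qed.
Let mulA x y z : mul x (mul y z) = mul (mul x y) z.
Proof. by case: gG => a _ _ _ _; exact: a. Qed.
Let mule x : mul x e = x. Proof. by case: gG. Qed.
Let emul x : mul e x = x. Proof. by case: gG. Qed.

Lemma contf_mul3 (X : topologicalType) (a b c : X -> G) f :
  continuous a -> continuous b -> continuous c -> contf f ->
  contf (fun z => f (mul (mul (a z) (b z)) (c z))).
Proof.
move=> ca cb cc cf; apply: (contf_mul cmul) cf => //.
move=> x; apply: (continuous_comp (f := fun z => (a z, b z)) (g := fun q => mul q.1 q.2)).
  exact: continuous_pair.
exact: cmul.
Qed.

Let cK f x y : contf f -> contf (fun k => f (mul (mul x k) y)).
Proof. by apply: contf_mul3 => z; [exact: cvg_cst|exact: cvg_id|exact: cvg_cst]. Qed.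
Arguments cK [f] x y _.

Let cJ f x : contf f -> contf (fun p : G * G => f (mul (mul (inv p.1) p.2) x)).
Proof.
apply: contf_mul3 => z; [|exact: cvg_snd|exact: cvg_cst].
by apply: (continuous_comp (f := fst)); [exact: cvg_fst|exact: cinv].
Qed.
Arguments cJ [f] x _.

(** Left invariance of [g] passes to [g ** f], whose value at [x] is then its mean over [mul k x];
    Fubini moves this mean inside. *)
Lemma conv_average g f x : contf g -> biK g -> contf f ->
  (g ** f) x = I (fun y => g y * J (fun k => f (mul (mul (inv y) k) x))).
Proof.
move=> cg [gl _] cf.
have gfl k : K k -> (g ** f) (mul k x) = (g ** f) x.
  move=> Kk; rewrite /gconv -(haarl hG k (f := fun y => g y * _)); last first.
    by apply: contfM => //; apply: (contf_mul cmul) cf => y; [exact: cinv|exact: cvg_cst].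
  congr I; apply/funext => y.
  by rewrite gl// (ginvM gG) -mulA (gmulVK gG).
pose H (q : G * G) : C := g q.2 * f (mul (mul (inv q.2) q.1) x).
have cH : contf H.
  apply: contfM; first by apply: (contf_comp _ cg) => q; exact: cvg_snd.
  exact: (contf_swap (cJ x cf)).
transitivity (J (fun k => I (fun y => H (k, y)))).
  rewrite [RHS](@meanK_eq _ _ _ _ _ _ _ _ hS _ ((g ** f) x))//; first exact: (mean_cont mI cG cH).
  move=> k Kk; rewrite -(gfl k Kk); congr I; apply/funext => y.
  by rewrite /H /= mulA.
rewrite (fubini cG bG mJ mI cH); congr I; apply/funext => y.
by rewrite -meanZ//; exact: (cK _ _ cf).
Qed.

Lemma minimal_spherical p : idem mul inv I K p -> p e != 0 ->
  minimal mul inv e I K p -> spherical_pd (fun x => (p e)^-1 * p x).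
Proof.
move=> ip0 pe mp; have [cp Ap sp pp] := ip0.
have p0 : 0 < p e by rewrite (lt_le_trans ltr01)// (idem_ge1 hS).
pose phi x := (p e)^-1 * p x; rewrite -/phi.
have cphi : contf phi by rewrite /phi; cont.
have Aphi : biK phi by exact: biKZ.
have phie : phi e = 1 by rewrite /phi mulVf.
split => //; last first.
  apply: posdefZ; first by rewrite invr_ge0 ltW.
  by rewrite -pp -{1}sp; exact: (star_conv_posdef hS).
have char g : contf g -> biK g -> g ** phi = fun x => (g ** phi) e * phi x.
  move=> cg Ag; have [c gp] := minimal_char hC hS ip0 mp cg Ag.
  have h : g ** phi = fun x => c * phi x.
    by rewrite (gconvZr hG)// gp; apply/funext => x; rewrite /phi mulrCA.
  by rewrite h phie mulr1.
have [phil phir] := Aphi.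
suff h y x : J (fun k => phi (mul (mul (inv y) k) x)) = phi (inv y) * phi x.
  by move=> x y; rewrite -{1 2}(ginvK gG x) h.
(* The defect of the functional equation, bi-invariant in [y]. Conjugating it and convolving with
   [phi] shows, by [conv_average] and the character property, that both terms of its squared norm
   agree. *)
pose D y := J (fun k => phi (mul (mul (inv y) k) x)) - phi (inv y) * phi x.
have cD : contf D.
  have h1 : contf (fun y => J (fun k => phi (mul (mul (inv y) k) x))).
    exact: (mean_cont mJ cG (cJ x cphi)).
  have h2 : contf (fun y => phi (inv y)) by exact: (contf_comp cinv).
  by rewrite /D; cont.
have AD : biK D.
  split=> k z Kk; rewrite /D (ginvM gG); congr (_ - _ * _).
  - rewrite -[RHS](meanK_l hS (KV Kk)); last exact: cK.
    by congr J; apply/funext => l; rewrite !mulA.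
  - by rewrite phir//; exact: KV.
  - by congr J; apply/funext => l; rewrite -!mulA phil//; exact: KV.
  - by rewrite phil//; exact: KV.
have AcD : biK (fun x => (D x)^*).
  by case: AD => dl dr; split=> k z Kk; rewrite ?(dl _ _ Kk) ?(dr _ _ Kk).
have ccD : contf (fun x => (D x)^*) by cont.
suff D0 : ip I D D = 0.
  by apply/eqP; rewrite -subr_eq0; have := ip_eq0 hG cD D0 y => /eqP.
have h1 := conv_average x ccD AcD cphi.
have h2 := congr1 (fun f => f x) (char _ ccD AcD); rewrite h1 in h2.
have c1 : contf (fun y => J (fun k => phi (mul (mul (inv y) k) x))).
  exact: (mean_cont mJ cG (cJ x cphi)).
have c2 : contf (fun y => phi (inv y)) by exact: (contf_comp cinv).
rewrite /ip (_ : (fun _ => _) = fun y =>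
   (D y)^* * J (fun k => phi (mul (mul (inv y) k) x)) - (D y)^* * phi (inv y) * phi x).
  rewrite meanB//; try by cont.
  rewrite h2 meanZr//; last by cont.
  have -> : ((fun z => (D z)^*) ** phi) e = I (fun z => (D z)^* * phi (inv z)).
    by congr I; apply/funext => z; rewrite mule.
  by rewrite subrr.
by apply/funext => z; rewrite {1}/D; ring.
Qed.

(** On a minimal idempotent [q] below the limit [r], convolution by [k ** k] is the scalar [mu > 0].
    Orthogonality of [h] to the spherical function of [q] forces [h ** q = 0], hence
    [k ** q = 0]. *)
Lemma spherical_complete h : contf h -> biK h ->
  (forall phi, spherical_pd phi -> ip I h phi = 0) -> forall x, h x = 0.
Proof.
move=> ch Ah hphi; apply: contrapT => /existsNP[x0 /eqP hx0].
have csh := contf_star hG ch; have Ash := biK_star hS Ah.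
pose k := h ** star h.
have ck : contf k by exact: (contf_conv hG).
have Ak : biK k by exact: (biK_conv hS).
have sk : star k = k by rewrite /k (star_conv hG)// (starK hG).
have ke : k e != 0.
  by rewrite /k (gconv_star_e hG); apply: contra_neq hx0 => /(ip_eq0 hG ch).
have [r [mu [mu0 ir re kr]]] := idempotent_limit_biK hC hS ck Ak sk ke.
have [q [iq qe qr qm]] := minimal_idem hC hS ir re.
have [cq Aq sq qq] := iq; have [cr Ar sr rr] := ir.
have hq : h ** q = fun=> 0.
  have [c hc] := minimal_char hC hS iq qm ch Ah.
  have := hphi _ (minimal_spherical iq qe qm).
  rewrite (_ : ip I h _ = (q e)^-1 * (c * q e)).
    move=> /eqP; rewrite mulf_eq0 invr_eq0 mulf_eq0 !(negbTE qe) orbF /= => /eqP c0.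
    by rewrite hc c0; apply/funext => x; rewrite mul0r.
  have -> : c * q e = ip I h q by rewrite -(gconv_star_e hG) sq hc.
  rewrite /ip.
  have qr' : (q e)^* = q e by apply: ge0_conjC; rewrite (le_trans ler01)// (idem_ge1 hS).
  rewrite -meanZ//; last by cont.
  by congr I; apply/funext => x; rewrite !conjE qr'; ring.
have kq : k ** q = fun=> 0.
  rewrite /k (gconvC hS ch csh)// (gconvA hG)// hq.
  by apply/funext => x; rewrite /gconv -[RHS](mean_cst mI); congr I; apply/funext => y; rewrite mulr0.
have : (k ** k) ** q = fun x => mu * q x.
  have ckk := contf_conv hG ck ck.
  by rewrite -{1}qr (gconvC hS cq cr)// -(gconvA hG)// kr (gconvZl hG)// (gconvC hS cr cq)// qr.
rewrite (gconvA hG)// kq => /(congr1 (fun f => f e)) /esym/eqP.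
rewrite (_ : (k ** _) e = 0).
  by rewrite mulf_eq0 (negbTE qe) gt_eqF.
by rewrite /gconv -[RHS](mean_cst mI); congr I; apply/funext => y; rewrite mulr0.
Qed.

Section Facts.
Variable phi : G -> C.
Hypothesis sphi : spherical_pd phi.

Lemma spherical_cont : contf phi. Proof. by case: sphi. Qed.
Let cphi := spherical_cont.
Lemma spherical_e : phi e = 1. Proof. by case: sphi. Qed.

(** As [phi e = 1], the functional equation writes [phi x] as the mean over [K] of [phi (l x)], or
    of [phi (x l)], and such a mean absorbs a factor from [K]. *)
Lemma spherical_biK : biK phi.
Proof.
case: sphi => _ phi1 eqphi _; split=> k x Kk.
  rewrite -[LHS]mul1r -phi1 -eqphi -[RHS]mul1r -phi1 -eqphi.
  rewrite -[RHS](meanK_r hS Kk); last exact: cK.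
  by congr J; apply/funext => y; rewrite !emul mulA.
rewrite -[LHS]mulr1 -phi1 -eqphi -[RHS]mulr1 -phi1 -eqphi.
rewrite -[RHS](meanK_l hS Kk); last exact: cK.
by congr J; apply/funext => y; rewrite !mule mulA.
Qed.

Lemma spherical_star : star phi = phi.
Proof.
case: sphi => _ _ _ pd; apply/funext => x.
by rewrite /gstar (posdefV gG pd) conjCK.
Qed.

Lemma spherical_norm_le x : `|phi x| <= 1.
Proof. by rewrite -spherical_e; case: sphi => _ _ _ /(posdef_norm_le gG); exact. Qed.

(** The functional equation factors the average in [conv_average]. *)
Lemma spherical_char g : contf g -> biK g -> g ** phi = fun x => ip I g phi * phi x.
Proof.
move=> cg Ag; apply/funext => x; case: sphi => _ _ eqphi pd.
rewrite (conv_average x cg Ag cphi) /ip -meanZr//; last by cont.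
by congr I; apply/funext => y; rewrite eqphi (posdefV gG pd) mulrA.
Qed.

Lemma spherical_idem : phi ** phi = fun x => ip I phi phi * phi x.
Proof. exact: spherical_char cphi spherical_biK. Qed.

Lemma spherical_ip_gt0 : 0 < ip I phi phi.
Proof.
rewrite lt0r ip_ge0// andbT; apply/eqP => /(ip_eq0 hG cphi)/(_ e).
by rewrite spherical_e => /eqP; rewrite oner_eq0.
Qed.
End Facts.

(** By commutativity the same convolution is a multiple of [psi] and of [phi]; evaluation at [e]
    shows that the two coefficients agree. *)
Lemma spherical_orth phi psi : spherical_pd phi -> spherical_pd psi ->
  phi <> psi -> ip I phi psi = 0.
Proof.
move=> s1 s2 ne; apply: contrapT => /eqP a0; apply: ne; apply/funext => x.
have c1 := spherical_cont s1; have c2 := spherical_cont s2.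
have A1 := spherical_biK s1; have A2 := spherical_biK s2.
have h1 := spherical_char s2 c1 A1; have h2 := spherical_char s1 c2 A2.
rewrite (gconvC hS c2)// h1 in h2.
have := congr1 (fun f => f e) h2; rewrite !spherical_e// !mulr1 => he.
by have := congr1 (fun f => f x) h2; rewrite -he => /(mulfI a0).
Qed.

End SphericalFunctions.

(** * Dimension of the span of the translates *)

Section IpSums.
Variables (C : numClosedFieldType) (T : topologicalType) (I : (T -> C) -> C).
Hypothesis mI : mean I.
Implicit Types f g : T -> C.

Lemma ip_suml (J : Type) (s : seq J) (t : J -> C) (h : J -> T -> C) g :
  (forall i, contf (h i)) -> contf g ->
  ip I (fun x => \sum_(i <- s) t i * h i x) g = \sum_(i <- s) t i * ip I (h i) g.
Proof.
move=> chi cg.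
have ci i : contf (fun x => h i x * (g x)^*) by have := chi i => ch; cont.
have cj i : contf (fun x => t i * (h i x * (g x)^*)) by have := ci i => ch; cont.
transitivity (\sum_(i <- s) I (fun x => t i * (h i x * (g x)^*))); last first.
  by apply: eq_bigr => i _; rewrite meanZ.
rewrite -mean_sum//; congr I; apply/funext => x.
by rewrite mulr_suml; apply: eq_bigr => i _; rewrite mulrA.
Qed.

Lemma ip_subl f g h : contf f -> contf g -> contf h ->
  ip I (fun x => f x - g x) h = ip I f h - ip I g h.
Proof.
move=> cf cg ch; rewrite /ip -meanB//; try by cont.
by congr I; apply/funext => x; rewrite mulrBl.
Qed.

Section Gram.
Variables (m : nat) (h : 'I_m -> T -> C).
Hypotheses (chi : forall i, contf (h i))
  (definite : forall f, contf f -> ip I f f = 0 -> forall x, f x = 0)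
  (hfree : forall c : 'I_m -> C, (forall x, \sum_(i < m) c i * h i x = 0) -> forall i, c i = 0).

Definition gram : 'M[C]_m := \matrix_(i, j) ip I (h i) (h j).

Let ccomb (t : 'I_m -> C) : contf (fun x => \sum_(i < m) t i * h i x).
Proof. by apply: contf_sum => i; have := @chi i => c; cont. Qed.

Lemma gram_unit : gram \in unitmx.
Proof.
rewrite unitmxE unitfE; apply/det0P => -[v v0 vM].
pose u x := \sum_(i < m) v 0 i * h i x.
have cu : contf u by exact: ccomb.
have uh j : ip I u (h j) = 0.
  have /matrixP/(_ 0 j) := vM; rewrite !mxE => <-.
  by rewrite (ip_suml _ _ chi)//; apply: eq_bigr => i _; rewrite mxE.
have uu : ip I u u = 0.
  rewrite {1}/u (ip_suml _ _ chi)// big1// => i _.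
  by rewrite (ipC mI)// uh conjC0 mulr0.
have h0 := definite cu uu.
move/eqP: v0; apply; apply/rowP => i; rewrite mxE.
exact: (hfree h0).
Qed.

Let M := gram.
Let N := invmx gram.

(** [E] is the squared norm of the orthogonal projection of [f] on the span of the [h i], written
    with the inverse Gram matrix: Bessel's inequality, with equality on the span. *)
Lemma gram_bessel f : contf f ->
  let E := \sum_(i < m) \sum_(j < m) ip I f (h j) * N j i * (ip I f (h i))^* in
  E <= ip I f f /\
  ((exists s : 'I_m -> C, forall x, f x = \sum_(i < m) s i * h i x) -> E = ip I f f).
Proof.
move=> cf E; pose a : 'rV[C]_m := \row_j ip I f (h j).
pose t := a *m N; pose p x := \sum_(i < m) t 0 i * h i x.
have cp : contf p by exact: ccomb.
have tM : t *m M = a by rewrite /t -mulmxA mulVmx ?mulmx1// gram_unit.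
have cfp : contf (fun x => f x - p x) by cont.
have orth j : ip I (fun x => f x - p x) (h j) = 0.
  rewrite ip_subl// (ip_suml _ _ chi)//.
  have /matrixP/(_ 0 j) := tM; rewrite !mxE => <-.
  by apply/eqP; rewrite subr_eq0; apply/eqP/eq_bigr => i _; rewrite [M _ _]mxE.
have pE : ip I (fun x => f x - p x) (fun x => f x - p x) = ip I f f - E.
  transitivity (ip I (fun x => f x - p x) f).
    rewrite (ipC mI)// ip_subl// (_ : ip I p _ = 0) ?subr0; last first.
      rewrite (ip_suml _ _ chi)// big1// => i _.
      by rewrite (ipC mI)// orth conjC0 mulr0.
    by rewrite [ip I f _](ipC mI)// conjCK.
  rewrite ip_subl//; congr (_ - _); rewrite (ip_suml _ _ chi)// /E.
  apply: eq_bigr => i _; rewrite (ipC mI cf)// mxE mulr_suml.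
  by apply: eq_bigr => j _; rewrite mxE.
split; first by rewrite -subr_ge0 -pE ip_ge0.
move=> [s fs]; pose r : 'rV[C]_m := \row_i s i.
have ar : a = r *m M.
  apply/rowP => j; rewrite !mxE.
  have -> : f = fun x => \sum_(i < m) s i * h i x by apply/funext.
  by rewrite (ip_suml _ _ chi)//; apply: eq_bigr => i _; rewrite mxE [M _ _]mxE.
have tr : t = r by rewrite /t ar -mulmxA mulmxV ?mulmx1// gram_unit.
have fp x : f x - p x = 0.
  by rewrite fs /p tr; apply/eqP; rewrite subr_eq0; apply/eqP/eq_bigr => i _; rewrite mxE.
apply/eqP; rewrite eq_sym -subr_eq0 -pE /ip.
by rewrite (_ : (fun _ => _) = fun=> 0) ?(mean_cst mI)//; apply/funext => x; rewrite fp mul0r.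
Qed.

Lemma gram_trace : \sum_(i < m) \sum_(j < m) N j i * ip I (h i) (h j) = m%:R.
Proof.
transitivity (\tr (M *m N)).
  by apply: eq_bigr => i _; rewrite mxE; apply: eq_bigr => j _; rewrite mxE mulrC.
by rewrite mulmxV ?gram_unit// mxtrace1.
Qed.

End Gram.
End IpSums.

Definition free_family (C : numClosedFieldType) (T : Type) (m : nat) (h : 'I_m -> T -> C) :=
  forall c : 'I_m -> C, (forall x, \sum_(i < m) c i * h i x = 0) -> forall i, c i = 0.

Section Dimension.
Variables (R : realType) (C : numClosedFieldType) (G : topologicalType).
Variables (mul : G -> G -> G) (inv : G -> G) (e : G) (I : (G -> C) -> C).
Variables (K : set G) (J : (G -> C) -> C).
Implicit Types f g h p : G -> C.
Local Notation "f ** g" := (gconv mul inv I f g) (at level 40, left associativity).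
Local Notation star := (gstar inv).
Local Notation spherical_pd := (spherical_pd mul inv e J).

Variable toC : {rmorphism R -> C}.
Hypotheses (hC : real_embedding toC) (hS : gelfand_setting mul inv e I K J).

Let hG : haar_setting mul inv e I. Proof. by case: hS. Qed.
Let mI : mean I. Proof. by case: hG => _ []. Qed.
Let gG : is_group mul inv e. Proof. by case: hG => -[]. Qed.
Let cmul : continuous (fun p : G * G => mul p.1 p.2). Proof. by case: hG => -[]. Qed.

Variable phi : G -> C.
Hypothesis sphi : spherical_pd phi.
Local Notation tr x := (fun y => phi (mul (inv x) y)).
Local Notation c := (ip I phi phi).

Let cphi : contf phi. Proof. exact: (spherical_cont sphi). Qed.
Let ctr x : contf (tr x). Proof. exact: (contf_mulr cmul). Qed.
Arguments ctr : clear implicits.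
Let c0 : 0 < c. Proof. exact: (spherical_ip_gt0 hS sphi). Qed.

(** Left translations commute with convolution by [phi] on the right. *)
Lemma conv_translate x : tr x ** phi = fun y => c * phi (mul (inv x) y).
Proof.
apply/funext => y; rewrite -[RHS](congr1 (fun f => f (mul (inv x) y)) (spherical_idem hS sphi)).
rewrite /gconv -(haarl hG (inv x) (f := fun z => phi z * _)); last first.
  apply: contfM => //; apply: (contf_mul cmul) cphi => z; last exact: cvg_cst.
  by case: hG => -[].
congr I; apply/funext => z; rewrite (ginvM gG) (ginvK gG); congr (_ * phi _).
by case: gG => a _ _ _ _; rewrite -a (gmulKV gG).
Qed.

(** The reproducing property on the eigenspace [v ** phi = c v]. *)
Lemma ip_translate v x : contf v -> v ** phi = (fun y => c * v y) ->
  ip I v (tr x) = c * v x.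
Proof.
move=> cv hv; rewrite -(congr1 (fun f => f x) hv) /ip /gconv.
congr I; apply/funext => y; congr (_ * _).
have /(congr1 (fun f => f (mul (inv y) x))) := spherical_star hS sphi.
by rewrite /gstar (ginvM gG) (ginvK gG).
Qed.

(* [c^-1 phi (y^-1 x)] is the reproducing kernel of the span of the translates,
   so its trace [c^-1] is the dimension. *)
Lemma translates_dim m (gs : 'I_m -> G) : free_family (fun i => tr (gs i)) ->
  m%:R * c <= 1 /\
  ((forall x, exists s : 'I_m -> C, forall y, phi (mul (inv x) y) =
      \sum_(i < m) s i * phi (mul (inv (gs i)) y)) -> m%:R * c = 1).
Proof.
move=> free; pose h i := tr (gs i).
have chi i : contf (h i) by exact: ctr.
have def := ip_eq0 hG.
have cr : c^* = c by apply: ge0_conjC; exact: ltW.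
have hV i x : ip I (tr x) (h i) = c * (h i x)^*.
  rewrite (ipC mI)// (ip_translate x (chi i)) ?conjE ?cr//.
  exact: conv_translate.
have trtr x : ip I (tr x) (tr x) = c.
  rewrite (ip_translate x (ctr x)); last exact: conv_translate.
  by case: gG => _ _ _ -> _; rewrite (spherical_e sphi) mulr1.
pose N := invmx (gram I h).
pose E x := \sum_(i < m) \sum_(j < m) (c * (h j x)^*) * N j i * (c * (h i x)^*)^*.
have EE x : \sum_(i < m) \sum_(j < m) ip I (tr x) (h j) * N j i * (ip I (tr x) (h i))^* = E x.
  by apply: eq_bigr => i _; apply: eq_bigr => j _; rewrite !hV.
have cij i j : contf (fun x => (c * (h j x)^*) * N j i * (c * (h i x)^*)^*).
  by have := chi i; have := chi j => c1 c2; cont.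
have cE : contf E by apply: contf_sum => i; apply: contf_sum => j; exact: cij.
(* Bessel's inequality for [tr x], of squared norm [c], is averaged over [x]; the trace of the Gram
   matrix times its inverse produces [m]. *)
have IE : I E = c * (m%:R * c).
  rewrite -(gram_trace mI chi def free) mean_sum//; last by move=> i; exact: contf_sum.
  rewrite mulrCA mulr_suml; apply: eq_bigr => i _.
  rewrite mean_sum// mulr_suml; apply: eq_bigr => j _.
  have c1 := chi i; have c2 := chi j.
  have -> : (fun x => c * (h j x)^* * N j i * (c * (h i x)^*)^*) =
      fun x => (N j i * (c * c)) * (h i x * (h j x)^*).
    by apply/funext => x; rewrite !conjE cr; ring.
  by rewrite meanZ//; [rewrite -/(ip I (h i) (h j)) /N; ring | cont].
have cc : contf (fun _ : G => c) by exact: contf_cst.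
split.
  rewrite -(ler_pM2l c0) mulr1 -IE -subr_ge0 -{1}(mean_cst mI c) -meanB//.
  apply: mean_ge0; [by []|by cont|].
  move=> x; rewrite subr_ge0 -EE -(trtr x).
  by case: (gram_bessel mI chi def free (ctr x)).
move=> span; apply: (mulfI (lt0r_neq0 c0)); rewrite mulr1 -IE -[RHS](mean_cst mI).
congr I; apply/funext => x; rewrite -EE -[RHS](trtr x).
by case: (gram_bessel mI chi def free (ctr x)) => _; apply; exact: span.
Qed.

(** A free family of maximal length spans: adjoining [x] as last index creates a relation in which
    its coefficient is nonzero. *)
Lemma translates_dim_eq n :
  (exists gs : 'I_n -> G, free_family (fun i => tr (gs i))) ->
  (forall gs : 'I_n.+1 -> G, ~ free_family (fun i => tr (gs i))) -> n%:R * c = 1.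
Proof.
move=> [gs free] nfree; apply: (proj2 (translates_dim free)) => x.
pose gs' (i : 'I_n.+1) := if unlift ord_max i is Some j then gs j else x.
have wl i : widen_ord (leqnSn n) i = lift ord_max i.
  by apply: val_inj; rewrite /= /bump leqNgt ltn_ord.
have /existsNP[d /not_implyP[d0 /existsNP[i di]]] := nfree gs'.
have {}d0 y : \sum_(j < n) d (lift ord_max j) * phi (mul (inv (gs j)) y) +
   d ord_max * phi (mul (inv x) y) = 0.
  rewrite -[RHS](d0 y) big_ord_recr /=; congr (_ + _ * phi (mul (inv _) _)).
    by apply: eq_bigr => j _; rewrite wl /gs' liftK.
  by rewrite /gs' unlift_none.
have dm : d ord_max != 0.
  apply/eqP => dm; apply: di.
  have h := free (fun j => d (lift ord_max j)) (fun y => _).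
  case: (unliftP ord_max i) => [j ->|->]; last exact: dm.
  by apply: h => y; have := d0 y; rewrite dm mul0r addr0.
exists (fun j => - d (lift ord_max j) / d ord_max) => y.
transitivity (- (\sum_(j < n) d (lift ord_max j) * phi (mul (inv (gs j)) y)) / d ord_max).
  by have /eqP := d0 y; rewrite addrC addr_eq0 => /eqP <-; rewrite mulrC mulKf.
rewrite -sumrN mulr_suml; apply: eq_bigr => j _; by field.
Qed.

(** Without a maximal length there would be free families of every length, whereas [m c <= 1] bounds
    the length. *)
Lemma translates_dim_exists : exists n,
  (exists gs : 'I_n -> G, free_family (fun i => tr (gs i))) /\
  (forall gs : 'I_n.+1 -> G, ~ free_family (fun i => tr (gs i))).
Proof.
apply: contrapT => hn.
have all n : exists gs : 'I_n -> G, free_family (fun i => tr (gs i)).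
  elim: n => [|n ih]; first by exists (fun=> e) => d _ [].
  apply: contrapT => /forallNP h; apply: hn; exists n; split => //.
have [r r0 rE] := toC_gt0P hC c0.
have [gs free] := all (Num.bound r^-1).
have [+ _] := translates_dim free.
rewrite rE -(rmorph_nat toC) -rmorphM -(rmorph1 toC) (toC_le hC).
rewrite -ler_pdivlMr// mul1r leNgt archi_boundP// invr_ge0 ltW//.
Qed.

End Dimension.

(** * Positivity of the coefficients *)

Section Coefficients.
Variables (R : realType) (C : numClosedFieldType) (G : topologicalType).
Variables (mul : G -> G -> G) (inv : G -> G) (e : G) (I : (G -> C) -> C).
Variables (K : set G) (J : (G -> C) -> C).
Implicit Types f g h p : G -> C.
Local Notation "f ** g" := (gconv mul inv I f g) (at level 40, left associativity).
Local Notation star := (gstar inv).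
Local Notation spherical_pd := (spherical_pd mul inv e J).

Hypothesis hS : gelfand_setting mul inv e I K J.

Let hG : haar_setting mul inv e I. Proof. by case: hS. Qed.
Let mI : mean I. Proof. by case: hG => _ []. Qed.
Let gG : is_group mul inv e. Proof. by case: hG => -[]. Qed.
Let cmul : continuous (fun p : G * G => mul p.1 p.2). Proof. by case: hG => -[]. Qed.
Let cinv : continuous inv. Proof. by case: hG => -[]. Qed.
Let cG : compact [set: G]. Proof. by case: hG => -[]. Qed.
Let bG : bumps C G. Proof. by case: hG => -[]. Qed.

Section Bounds.
Variables (F p : G -> C).
Hypotheses (cF : contf F) (pF : posdef mul inv F)
  (cp : contf p) (sp : star p = p) (pp : p ** p = p).

Let cFm : contf (fun a : G * G => F (mul (inv a.1) a.2)).
Proof.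
apply: (contf_mul cmul) cF => a; last exact: cvg_snd.
by apply: (continuous_comp (f := fst)); [exact: cvg_fst|exact: cinv].
Qed.
Let cp1 : contf (fun a : G * G => p a.1).
Proof. by apply: (contf_comp _ cp) => a; exact: cvg_fst. Qed.
Let cp2 : contf (fun a : G * G => p a.2).
Proof. by apply: (contf_comp _ cp) => a; exact: cvg_snd. Qed.
Let H (a : G * G) : C := F (mul (inv a.1) a.2) * p a.1 * (p a.2)^*.
Let cH : contf H. Proof. by rewrite /H; cont. Qed.

(** Substituting [x y] for [y] isolates [F y]; the remaining mean over [x] is the conjugate of
    [(star p ** p) y], that is, of [p y]. *)
Let iterated : I (fun x => I (fun y => H (x, y))) = ip I F p.
Proof.
have cFs : contf (fun a : G * G => F a.2).
  by apply: (contf_comp _ cF) => a; exact: cvg_snd.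
have cpm : contf (fun a : G * G => p (mul a.1 a.2)).
  by apply: (contf_mul cmul) cp => a; [exact: cvg_fst|exact: cvg_snd].
pose H' (a : G * G) : C := F a.2 * p a.1 * (p (mul a.1 a.2))^*.
have cH' : contf H' by rewrite /H'; cont.
transitivity (I (fun x => I (fun y => H' (x, y)))).
  congr I; apply/funext => x; rewrite -(haarl hG x (f := fun y => H (x, y))).
    by congr I; apply/funext => y; rewrite /H /H' /= (gmulVK gG).
  exact: contf_slicer.
rewrite (fubini cG bG mI mI cH'); congr I; apply/funext => y.
have cpy : contf (fun x => p (mul x y)) by exact: (contf_mull cmul).
transitivity (F y * I (fun x => p x * (p (mul x y))^*)).
  rewrite -meanZ//; last by cont.
  by congr I; apply/funext => x; rewrite /H' /= mulrA.
have pE : I (fun x => star p x * p (mul (inv x) y)) = p y.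
  by rewrite sp; exact: (congr1 (fun f => f y) pp).
congr (_ * _); rewrite -pE -mean_conj//; last first.
  have csp := contf_star hG cp.
  by apply: contfM => //; apply: (contf_mul cmul) cp => x; [exact: cinv|exact: cvg_cst].
rewrite -(haarV hG (f := fun x => p x * _)); last by cont.
by congr I; apply/funext => x; rewrite /gstar !conjE.
Qed.

(** The Riemann sums of the double mean are forms of [F] with coefficients [p x * w x]. *)
Lemma posdef_ip_ge0 : 0 <= ip I F p.
Proof.
rewrite -iterated; apply: (mean2_ge0 cG bG mI cH) => s w w0 _.
have := @posdef_seq _ _ _ _ F _ s id (fun x => p x * w x) pF.
congr (0 <= _); apply: eq_bigr => x _; apply: eq_bigr => y _.
by rewrite /H conjE (ge0_conjC (w0 y)) /=; ring.
Qed.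

(* Positivity of [F] against the measure [delta_e - p]. *)
Lemma posdef_ip_le : ip I F p <= F e.
Proof.
have [_ _ r _ _] := gG; have l : forall x, mul e x = x by case: gG.
pose H1 (a : G * G) : C := F (inv a.1) * p a.1 + F a.2 * (p a.2)^*.
have cFi : contf (fun a : G * G => F (inv a.1)).
  apply: (contf_comp _ cF) => a.
  by apply: (continuous_comp (f := fst)); [exact: cvg_fst|exact: cinv].
have cFs : contf (fun a : G * G => F a.2).
  by apply: (contf_comp _ cF) => a; exact: cvg_snd.
(* Expands the form of [F] for [delta_e - p]. Its double mean is [F e - 2 <F, p> + <F, p>]. *)
pose H2 (a : G * G) : C := H a - H1 a + F e.
have cH1 : contf H1 by rewrite /H1; cont.
have cH2 : contf H2 by rewrite /H2; cont.
have -> : (ip I F p <= F e) = (0 <= I (fun x => I (fun y => H2 (x, y)))).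
  have cHr x : contf (fun y => H (x, y)) by exact: contf_slicer.
  have cH1r x : contf (fun y => H1 (x, y)) by exact: contf_slicer.
  have cHx : contf (fun x => I (fun y => H (x, y))) by exact: (mean_cont mI cG cH).
  have cH1x : contf (fun x => I (fun y => H1 (x, y))) by exact: (mean_cont mI cG cH1).
  have -> : (fun x => I (fun y => H2 (x, y))) =
      fun x => I (fun y => H (x, y)) - I (fun y => H1 (x, y)) + F e.
    apply/funext => x; rewrite /H2 meanD//; try by cont.
    by rewrite meanB// (mean_cst mI).
  rewrite meanD//; try by cont.
  rewrite meanB// (mean_cst mI) iterated.
  have -> : I (fun x => I (fun y => H1 (x, y))) = ip I F p + ip I F p.
    have cFp : contf (fun x => F (inv x) * p x).
      by apply: contfM => //; exact: (contf_comp cinv).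
    transitivity (I (fun x => F (inv x) * p x + ip I F p)).
      congr I; apply/funext => x; rewrite /H1 /= meanD//; try by cont.
      by rewrite (mean_cst mI).
    rewrite meanD//; last exact: contf_cst.
    rewrite (mean_cst mI) -(haarV hG cFp); congr (_ + _).
    congr I; apply/funext => x; rewrite (ginvK gG) -[in RHS]sp /gstar conjCK.
    by [].
  by rewrite -subr_ge0; congr (0 <= _); ring.
apply: (mean2_ge0 cG bG mI cH2) => s w w0 w1.
have wr y : (w y)^* = w y by exact: ge0_conjC.
(* The Dirac mass becomes an extra point [e] with coefficient -1. *)
have := @posdef_seq _ _ _ _ F _ ((e, -1) :: [seq (y, p y * w y) | y <- s]) fst snd pF.
rewrite !big_cons !big_map /= (ginv1 gG) l.
have -> : \sum_(y <- s) F (mul e y) * -1 * (p y * w y)^* =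
    - \sum_(y <- s) w y * (F y * (p y)^*).
  by rewrite -sumrN; apply: eq_bigr => y _; rewrite l conjE wr; ring.
have -> : \sum_(x <- s) \sum_(k <- (e, -1) :: [seq (y, p y * w y) | y <- s])
    F (mul (inv x) k.1) * (p x * w x) * (k.2)^* =
    - (\sum_(x <- s) w x * (F (inv x) * p x)) +
    \sum_(x <- s) \sum_(y <- s) w x * w y * H (x, y).
  rewrite -sumrN -big_split /=; apply: eq_bigr => x _.
  rewrite big_cons big_map /= r; congr (_ + _); first by rewrite !conjE; ring.
  by apply: eq_bigr => y _; rewrite /H conjE wr /=; ring.
congr (0 <= _).
have -> : \sum_(x <- s) \sum_(y <- s) w x * w y * H2 (x, y) =
    \sum_(x <- s) (\sum_(y <- s) w x * w y * H (x, y) - w x * (F (inv x) * p x)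
      - w x * (\sum_(y <- s) w y * (F y * (p y)^*)) + w x * F e).
  apply: eq_bigr => x _.
  transitivity (\sum_(y <- s) (w x * w y * H (x, y) - w y * (w x * (F (inv x) * p x))
     - w x * (w y * (F y * (p y)^*)) + w y * (w x * F e))).
    by apply: eq_bigr => y _; rewrite /H2 /H1 /=; ring.
  by rewrite big_split !sumrB /= -!mulr_suml -mulr_sumr w1 !mul1r.
rewrite big_split !sumrB /= -!mulr_suml w1 !mul1r !conjE; ring.
Qed.

End Bounds.

Section Product.
Variables (L : Type) (mulL : L -> L -> L) (invL : L -> L).
Let mulP (a b : G * L) := (mul a.1 b.1, mulL a.2 b.2).
Let invP (a : G * L) := (inv a.1, invL a.2).

(** [phi] is a positive multiple of [star phi ** phi]. *)
Lemma spherical_posdefM phi (B : L -> C) : spherical_pd phi -> posdef mulL invL B ->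
  posdef mulP invP (fun a => B a.2 * phi a.1).
Proof.
move=> sphi pB; have cphi := spherical_cont sphi.
have c0 := spherical_ip_gt0 hS sphi.
have -> : (fun a : G * L => B a.2 * phi a.1) =
    fun a => (ip I phi phi)^-1 * (B a.2 * (star phi ** phi) a.1).
  apply/funext => a; rewrite (spherical_star hS sphi) (spherical_idem hS sphi).
  by rewrite mulrCA mulKf// gt_eqF.
apply: posdefZ; first by rewrite invr_ge0 ltW.
exact: (star_conv_posdefM hS).
Qed.

(** For fixed [us] and [c] the form equals [<F, p>], where [F] combines the slices of [f]. [F] is
    positive definite on [G]: test [f] at the points [(xs a, us j)] with coefficients
    [d a * c j]. *)
Lemma coeff_posdef (f : G * L -> C) p :
  (forall u, contf (fun x => f (x, u))) -> posdef mulP invP f ->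
  contf p -> star p = p -> p ** p = p -> posdef mulL invL (fun u => ip I (fun x => f (x, u)) p).
Proof.
move=> cf pf cp sp pp n us c.
pose t (q : 'I_n * 'I_n) := c q.1 * (c q.2)^*.
pose h (q : 'I_n * 'I_n) x := f (x, mulL (invL (us q.1)) (us q.2)).
have ch q : contf (h q) by exact: cf.
pose F x := \sum_q t q * h q x.
have cF : contf F by apply: contf_sum => q; have := ch q => c1; cont.
rewrite pair_bigA /= (eq_bigr (fun q => t q * ip I (h q) p)); last first.
  by move=> q _; rewrite -mulrA mulrC.
rewrite -(ip_suml mI _ t ch cp).
apply: posdef_ip_ge0 => // m xs d.
have := @posdef_seq _ _ mulP invP f _ (index_enum ('I_m * 'I_n)%type)
  (fun q => (xs q.1, us q.2)) (fun q => d q.1 * c q.2) pf.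
congr (0 <= _).
transitivity (\sum_(a < m) \sum_(j < n) \sum_(b < m) \sum_(k < n)
    f (mul (inv (xs a)) (xs b), mulL (invL (us j)) (us k)) * (d a * c j) * (d b * c k)^*).
  rewrite [RHS]pair_bigA /=; apply: eq_bigr => q _.
  by rewrite [RHS]pair_bigA.
apply: eq_bigr => a _; rewrite exchange_big; apply: eq_bigr => b _ /=.
rewrite /F mulr_suml mulr_suml pair_bigA /=; apply: eq_bigr => q _.
by rewrite /h /t !conjE; ring.
Qed.

End Product.
End Coefficients.

(** * Spherical expansions *)

Lemma esum_small_tail (R : realType) (T : choiceType) (Z : set T) (r : T -> R) :
  (forall i, Z i -> 0 <= r i) -> (\esum_(i in Z) (r i)%:E < +oo)%E ->
  forall eps, 0 < eps -> exists F0, [/\ finite_set F0, F0 `<=` Z &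
    forall A, finite_set A -> A `<=` Z -> A `&` F0 `<=` set0 -> \sum_(i \in A) r i <= eps].
Proof.
move=> r0 roo eps eps0.
have fin : (\esum_(i in Z) (r i)%:E)%E \is a fin_num.
  by rewrite ge0_fin_numE// esum_ge0// => i Zi; rewrite lee_fin r0.
have [_ [F0 [fF0 F0Z] <-] hF0] := ub_ereal_sup_adherent eps0 fin.
exists F0; split => // A fA AZ AF0.
have : ((\sum_(i \in A `|` F0) r i)%:E <= \esum_(i in Z) (r i)%:E)%E.
  rewrite -fsumEFin; last by rewrite finite_setU.
  apply: esum_ge; exists (A `|` F0) => //; split; first by rewrite finite_setU.
  by move=> i [/AZ|/F0Z].
rewrite fsbigU0//; move: hF0; rewrite -/(esum _ _) fsumEFin//.
by move: fin => /fineK <-; rewrite -EFinB lte_fin lee_fin /=; lra.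
Qed.

Lemma esum_ltoo (R : realType) (T : choiceType) (Z : set T) (r : T -> R) (M : R) :
  (forall A, finite_set A -> A `<=` Z -> \sum_(i \in A) r i <= M) ->
  (\esum_(i in Z) (r i)%:E < +oo)%E.
Proof.
move=> h; apply: (@le_lt_trans _ _ M%:E); last exact: ltry.
apply: ge_ereal_sup => _ [A [fA AZ] <-].
by rewrite fsumEFin// lee_fin h.
Qed.

Section Sums.
Variables (C : numClosedFieldType) (T : choiceType) (Z : set T).

Lemma fsum_norm_le (A : set T) (a b : T -> C) : finite_set A ->
  (forall i, A i -> `|a i| <= b i) -> `|\sum_(i \in A) a i| <= \sum_(i \in A) b i.
Proof.
move=> fA ab; rewrite !fsbig_finite//=.
apply: le_trans (ler_norm_sum _ _ _) _.
rewrite big_seq [leRHS]big_seq; apply: ler_sum => i.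
by rewrite in_fset_set// inE; exact: ab.
Qed.

Definition small_tails (b : T -> C) := forall e : C, 0 < e ->
  exists F0, [/\ finite_set F0, F0 `<=` Z &
    forall A, finite_set A -> A `<=` Z -> A `&` F0 `<=` set0 -> \sum_(i \in A) b i <= e].

Definition unif_sum (P : Type) (a : T -> P -> C) (g : P -> C) := forall e : C, 0 < e ->
  exists F0, [/\ finite_set F0, F0 `<=` Z &
    forall A, finite_set A -> F0 `<=` A -> A `<=` Z ->
      forall p, `|g p - \sum_(i \in A) a i p| <= e].

Variables (P : Type) (a : T -> P -> C) (b : T -> C).
Hypotheses (ab : forall i p, Z i -> `|a i p| <= b i) (tb : small_tails b).

Lemma small_tails_cauchy (e : C) : 0 < e ->
  exists F0, [/\ finite_set F0, F0 `<=` Z &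
    forall A B, finite_set A -> finite_set B -> F0 `<=` A -> F0 `<=` B ->
      A `<=` Z -> B `<=` Z ->
      forall p, `|\sum_(i \in A) a i p - \sum_(i \in B) a i p| <= e].
Proof.
move=> e0; have e2 : 0 < e / 2 by rewrite divr_gt0// ltr0n.
have [F0 [fF0 F0Z hF0]] := tb e2.
exists F0; split => // A B fA fB FA FB AZ BZ p.
have split_sum D : finite_set D -> F0 `<=` D -> D `<=` Z -> exists2 s,
    \sum_(i \in D) a i p = \sum_(i \in F0) a i p + s & `|s| <= e / 2.
  move=> fD FD DZ; exists (\sum_(i \in D `&` ~` F0) a i p).
    by rewrite (fsbigID F0)//= (setIidr FD).
  have fD' : finite_set (D `&` ~` F0) by exact: finite_setIl.
  apply: le_trans (fsum_norm_le (b := b) fD' _) _ => [i [/DZ Zi _]|]; first exact: ab.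
  by apply: hF0 => // i [] => [/DZ|[_ h /h]].
have [s -> hs] := split_sum A fA FA AZ; have [t -> ht] := split_sum B fB FB BZ.
rewrite opprD addrACA subrr add0r.
by apply: le_trans (ler_normB _ _) _; rewrite (splitr e) lerD.
Qed.

Lemma small_tails_unif g :
  (forall p (e : C), 0 < e -> exists F0 : set T, [/\ finite_set F0, F0 `<=` Z &
      forall A, finite_set A -> F0 `<=` A -> A `<=` Z -> `|g p - \sum_(i \in A) a i p| <= e]) ->
  unif_sum a g.
Proof.
move=> hg e e0; have e2 : 0 < e / 2 by rewrite divr_gt0// ltr0n.
have [F0 [fF0 F0Z hF0]] := small_tails_cauchy e2.
exists F0; split => // A fA FA AZ p.
(* [F1] depends on [p], but the comparison of [A] with its union with [F1] does not. *)
have [F1 [fF1 F1Z hF1]] := hg p _ e2.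
have fU : finite_set (A `|` F1) by rewrite finite_setU.
have UZ : A `|` F1 `<=` Z by move=> i [/AZ|/F1Z].
have h1 := hF1 _ fU (@subsetUr _ _ _) UZ.
have h2 := hF0 _ _ fU fA (subset_trans FA (@subsetUl _ _ _)) FA UZ AZ p.
rewrite -(subrKA (\sum_(i \in A `|` F1) a i p)).
by apply: le_trans (ler_normD _ _) _; rewrite (splitr e) lerD.
Qed.

Variables (R : realType) (toC : {rmorphism R -> C}).
Hypothesis hC : real_embedding toC.

(** [Z] may be uncountable. The sum is taken along an increasing sequence of finite sets [U n]
    adapted to the errors [1 / (n + 1)], to which all large finite sets are then compared. *)
Lemma small_tails_exists : exists g, unif_sum a g.
Proof.
pose eps n : C := n.+1%:R^-1.
have eps0 n : 0 < eps n by rewrite invr_gt0 ltr0n.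
have epsN e : 0 < e -> exists N, forall n, (N <= n)%N -> eps n <= e.
  move=> /(toC_gt0P hC)[r r0 ->]; exists (Num.bound r^-1) => n Nn.
  rewrite /eps -(rmorph_nat toC) -fmorphV (toC_le hC).
  rewrite -[leRHS]invrK lef_pV2 ?posrE ?invr_gt0 ?ltr0n//.
  apply: le_trans (ltW (archi_boundP _)) _; first by rewrite invr_ge0 ltW.
  by rewrite ler_nat (leq_trans Nn).
have /choice[F hF] n := small_tails_cauchy (eps0 n).
pose U := fix U n := if n is n'.+1 then U n' `|` F n else F 0%N.
have fU n : finite_set (U n).
  elim: n => [|n ih] /=; first by case: (hF 0%N).
  by rewrite finite_setU; split=> //; case: (hF n.+1).
have UZ n : U n `<=` Z.
  elim: n => [|n ih] /=; first by case: (hF 0%N).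
  by move=> i [/ih//|]; case: (hF n.+1) => _ h _; exact: h.
have FU m n : (m <= n)%N -> F m `<=` U n.
  elim: n => [|n ih]; first by rewrite leqn0 => /eqP ->.
  rewrite leq_eqVlt => /predU1P[->|/ih h] i Fi; first by right.
  by left; exact: h.
have [g hg] : exists g : P -> C, forall e : C, 0 < e -> exists N, forall n, (N <= n)%N ->
    forall x, `|g x - \sum_(i \in U n) a i x| <= e.
  apply: (unif_cauchy_lim hC) => e /epsN[N hN]; exists N => m n Nm Nn x.
  apply: le_trans (hN _ (leqnn _)); case: (hF N) => _ _; apply => //; exact: FU.
exists g => e e0; have e2 : 0 < e / 2 by rewrite divr_gt0// ltr0n.
have [N hN] := epsN _ e2; have [M hM] := hg _ e2.
have [fFN FNZ hFN] := hF N.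
exists (F N); split => // A fA FA AZ p; pose n := maxn N M.
have h1 := hM n (leq_maxr _ _) p.
have h2 := hFN _ _ (fU n) fA (FU _ _ (leq_maxl _ _)) FA (UZ n) AZ p.
rewrite -(subrKA (\sum_(i \in U n) a i p)).
apply: le_trans (ler_normD _ _) _; rewrite (splitr e) lerD//.
exact: le_trans h2 (hN _ (leqnn _)).
Qed.

End Sums.

Section Expansion.
Variables (R : realType) (C : numClosedFieldType) (G : topologicalType).
Variables (mul : G -> G -> G) (inv : G -> G) (e : G) (I : (G -> C) -> C).
Variables (K : set G) (J : (G -> C) -> C).
Local Notation "f ** g" := (gconv mul inv I f g) (at level 40, left associativity).
Local Notation star := (gstar inv).
Local Notation Z := [set phi | spherical_pd mul inv e J phi].

Variable toC : {rmorphism R -> C}.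
Hypotheses (hC : real_embedding toC) (hS : gelfand_setting mul inv e I K J).

Let hG : haar_setting mul inv e I. Proof. by case: hS. Qed.
Let mI : mean I. Proof. by case: hG => _ []. Qed.
Let gG : is_group mul inv e. Proof. by case: hG => -[]. Qed.

(** Zero outside [Z], because [ip_suml] and [contf_sum] ask continuity at every index. *)
Let total phi : G -> C := if `[< Z phi >] then phi else fun=> 0.

Let contf_total phi : contf (total phi).
Proof.
rewrite /total; case: asboolP => [Zphi|_]; last exact: contf_cst.
exact: (spherical_cont Zphi).
Qed.

Let fsum_total (A : set (G -> C)) (b : (G -> C) -> C) : finite_set A -> A `<=` Z ->
  (fun x => \sum_(phi \in A) b phi * phi x) =
  fun x => \sum_(phi <- finmap.enum_fset (fset_set A)) b phi * total phi x.
Proof.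
move=> fA AZ; apply/funext => x; rewrite fsbig_finite//=; apply: eq_big_seq => phi.
by rewrite in_fset_set// inE /total => /AZ Zphi; case: asboolP.
Qed.

Lemma contf_fsum (A : set (G -> C)) (b : (G -> C) -> C) : finite_set A -> A `<=` Z ->
  contf (fun x => \sum_(phi \in A) b phi * phi x).
Proof.
move=> fA AZ; rewrite fsum_total//; apply: contf_sum => phi.
by have := @contf_total phi => c; cont.
Qed.

Arguments contf_fsum [A] b _ _.

Lemma ip_fsum (A : set (G -> C)) (b : (G -> C) -> C) psi : finite_set A -> A `<=` Z ->
  A psi -> ip I (fun x => \sum_(phi \in A) b phi * phi x) psi = b psi * ip I psi psi.
Proof.
move=> fA AZ Apsi; have Zpsi := AZ _ Apsi; have cpsi := spherical_cont Zpsi.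
rewrite fsum_total// (ip_suml mI _ _ contf_total cpsi).
rewrite -(fsbig_finite _ (fun phi => b phi * ip I (total phi) psi))//=.
rewrite (fsbigD1 psi)//= fsbig1 ?addr0; first by rewrite /total; case: asboolP.
move=> phi [Aphi ne]; rewrite /total; case: asboolP => [Zphi|/(_ (AZ _ Aphi))//].
by rewrite (spherical_orth hS Zphi Zpsi ne) mulr0.
Qed.

Lemma unif_sum_cont (b : (G -> C) -> C) g :
  unif_sum Z (fun phi x => b phi * phi x) g -> contf g.
Proof.
move=> hg.
have /choice[F hF] (n : nat) : exists F : set (G -> C), [/\ finite_set F, F `<=` Z &
    forall x, `|g x - \sum_(phi \in F) b phi * phi x| <= n.+1%:R^-1].
  have [|F [fF FZ hF]] := hg n.+1%:R^-1; first by rewrite invr_gt0 ltr0n.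
  by exists F; split => // x; exact: hF.
apply: (@contf_unif_lim _ _ _ (fun n x => \sum_(phi \in F n) b phi * phi x)).
  by move=> n; apply: contf_fsum; case: (hF n).
move=> d /(toC_gt0P hC)[r r0 ->]; exists (Num.bound r^-1) => x.
have [_ _ h] := hF (Num.bound r^-1); apply: le_trans (h x) _.
rewrite -(rmorph_nat toC) -fmorphV (toC_le hC) -[leRHS]invrK.
rewrite lef_pV2 ?posrE ?invr_gt0 ?ltr0n//.
apply: le_trans (ltW (archi_boundP _)) _; first by rewrite invr_ge0 ltW.
by rewrite ler_nat.
Qed.

Lemma unif_sum_coeff (b : (G -> C) -> C) g psi : contf g ->
  unif_sum Z (fun phi x => b phi * phi x) g -> Z psi ->
  ip I g psi = b psi * ip I psi psi.
Proof.
move=> cg hg Zpsi; have cpsi := spherical_cont Zpsi.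
apply: (@eq_of_close _ _ _ 1) => d d0; rewrite mul1r.
have [F [fF FZ hF]] := hg _ d0.
(* Adding [psi] ensures that its term is the one that survives orthogonality. *)
have fA : finite_set (F `|` [set psi]) by rewrite finite_setU; split => //; exact: finite_set1.
have AZ : F `|` [set psi] `<=` Z by move=> phi [/FZ//|->].
have cA := contf_fsum b fA AZ.
rewrite -(ip_fsum b fA AZ); last by right.
rewrite -(ip_subl mI cg cA cpsi); apply: (mean_norm_le mI).
  by have h := contfB cg cA; cont.
move=> x; rewrite normrM norm_conjC -[leRHS]mulr1 ler_pM//.
  by apply: hF => //; exact: subsetUl.
exact: (spherical_norm_le hS).
Qed.

(* The majorant gives a uniform limit of the expansion, and completeness
   identifies it with [h]. *)
Lemma spherical_expansion h (b : (G -> C) -> C) : contf h -> biK mul K h ->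
  (forall phi, Z phi -> `|ip I h phi / ip I phi phi| <= b phi) -> small_tails Z b ->
  unif_sum Z (fun phi x => ip I h phi / ip I phi phi * phi x) h.
Proof.
move=> ch Ah hb tb; pose a phi := ip I h phi / ip I phi phi.
have ab phi x : Z phi -> `|a phi * phi x| <= b phi.
  move=> Zphi; rewrite normrM -[leRHS]mulr1 ler_pM//; first exact: hb.
  exact: (spherical_norm_le hS).
have [g hg] := small_tails_exists ab tb hC.
have cg := unif_sum_cont hg.
suff hE : forall x, h x - g x = 0.
  have gh : g = h by apply/funext => x; apply/esym/eqP; rewrite -subr_eq0 hE.
  by rewrite gh in hg.
have Ag : biK mul K g.
  (* [g] cannot separate points that no spherical function separates. *)
  have gE x y : (forall phi, Z phi -> phi x = phi y) -> g x = g y.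
    move=> xy; apply: (@eq_of_close _ _ _ 2) => d d0.
    have [F [fF FZ hF]] := hg _ d0.
    have h1 := hF F fF (@subset_refl _ _) FZ.
    have := h1 x; have h2 := h1 y.
    rewrite (_ : \sum_(phi \in F) a phi * phi x = \sum_(phi \in F) a phi * phi y); last first.
      by apply: eq_fsbigr => phi; rewrite inE => /FZ/xy ->.
    move=> h3; rewrite -(subrKA (\sum_(phi \in F) a phi * phi y)) (le_trans (ler_normD _ _))//.
    by rewrite mulr_natl mulr2n lerD// distrC.
  by split=> k x Kk; apply: gE => phi /(spherical_biK hS)[l r]; [exact: l|exact: r].
apply: (spherical_complete hC hS); [by cont|exact: biKB|].
move=> phi Zphi; have cphi := spherical_cont Zphi.
rewrite (ip_subl mI ch cg cphi) (unif_sum_coeff cg hg Zphi) divfK ?subrr//.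
by rewrite gt_eqF// (spherical_ip_gt0 hS Zphi).
Qed.

(* For [P = \sum_(phi \in A) phi / |phi|^2], a self-adjoint idempotent, the sum
   is the inner product of [F] and [P]. *)
Lemma coeff_sum_le F (A : set (G -> C)) : contf F -> posdef mul inv F ->
  finite_set A -> A `<=` Z -> \sum_(phi \in A) (ip I F phi / ip I phi phi) <= F e.
Proof.
move=> cF pF fA AZ.
pose n phi := (ip I phi phi)^-1.
have n0 phi : Z phi -> 0 < n phi.
  by move=> Zphi; rewrite invr_gt0 (spherical_ip_gt0 hS Zphi).
pose P x := \sum_(phi \in A) n phi * phi x.
have cP : contf P by exact: contf_fsum.
pose s := finmap.enum_fset (fset_set A).
have PE : P = fun x => \sum_(phi <- s) n phi * total phi x by exact: fsum_total.
have Zs phi : phi \in s -> Z phi by rewrite in_fset_set// inE => /AZ.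
have Ps : star P = P.
  rewrite PE; apply/funext => x; rewrite /gstar conj_sum; apply: eq_big_seq => phi ps.
  have Zphi := Zs _ ps; rewrite conjE (ge0_conjC (ltW (n0 _ Zphi))); congr (_ * _).
  rewrite /total; case: asboolP => // _.
  by have /(congr1 (fun f => f x)) := spherical_star hS Zphi.
have ipP phi : A phi -> ip I P phi = 1.
  move=> Aphi; rewrite ip_fsum// /n mulVf// gt_eqF//.
  exact: (spherical_ip_gt0 hS (AZ _ Aphi)).
have AP : biK mul K P.
  split=> k x Kk; apply: eq_fsbigr => phi; rewrite inE => /AZ Zphi;
    by have [l r] := spherical_biK hS Zphi; rewrite ?(l _ _ Kk) ?(r _ _ Kk).
(* Term by term: [phi ** P = P ** phi = <P, phi> phi = phi]. *)
have PP : P ** P = P.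
  apply/funext => x.
  have cPx : contf (fun y => (P (mul (inv y) x))^*).
    apply: contf_conj; case: hG => -[_ cm ci _ _] _.
    by apply: (contf_mul cm) cP => y; [exact: ci|exact: cvg_cst].
  transitivity (ip I P (fun y => (P (mul (inv y) x))^*)).
    by congr I; apply/funext => y; rewrite conjCK.
  rewrite {1}PE (ip_suml mI _ _ contf_total cPx) [RHS](congr1 (fun f => f x) PE).
  apply: eq_big_seq => phi ps; congr (_ * _); have Zphi := Zs _ ps.
  have -> : total phi = phi by rewrite /total; case: asboolP.
  transitivity ((phi ** P) x); first by congr I; apply/funext => y; rewrite conjCK.
  have cphi := spherical_cont Zphi.
  rewrite (gconvC hS cphi cP (spherical_biK hS Zphi) AP) (spherical_char hS Zphi cP AP).
  by rewrite ipP ?mul1r//; move: ps; rewrite in_fset_set// inE.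
suff -> : \sum_(phi \in A) (ip I F phi / ip I phi phi) = ip I F P.
  exact: (posdef_ip_le hS cF pF cP Ps PP).
rewrite (ipC mI cP cF) PE (ip_suml mI _ _ contf_total cF) conj_sum fsbig_finite//=.
apply: eq_big_seq => phi ps; have Zphi := Zs _ ps.
rewrite conjE (ge0_conjC (ltW (n0 _ Zphi))) mulrC; congr (_ * _).
have -> : total phi = phi by rewrite /total; case: asboolP.
by rewrite (ipC mI cF (spherical_cont Zphi)) conjCK.
Qed.

End Expansion.

(** * Expansions on the product group *)

Lemma posdef_sum (C : numClosedFieldType) (X : Type) (mul : X -> X -> X) (inv : X -> X)
  (T : eqType) (s : seq T) (F : T -> X -> C) :
  (forall i, i \in s -> posdef mul inv (F i)) ->
  posdef mul inv (fun x => \sum_(i <- s) F i x).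
Proof.
move=> pF n xs c.
rewrite (_ : \sum_(j < n) _ = \sum_(i <- s) \sum_(j < n) \sum_(k < n)
    F i (mul (inv (xs j)) (xs k)) * c j * (c k)^*).
  by rewrite big_seq sumr_ge0// => i /pF; exact.
rewrite [RHS]exchange_big; apply: eq_bigr => j _.
rewrite [RHS]exchange_big; apply: eq_bigr => k _ /=.
by rewrite !mulr_suml.
Qed.

Section ProductExpansion.
Variables (R : realType) (C : numClosedFieldType) (G : topologicalType).
Variables (mul : G -> G -> G) (inv : G -> G) (e : G) (I : (G -> C) -> C).
Variables (K : set G) (J : (G -> C) -> C).
Local Notation "f ** g" := (gconv mul inv I f g) (at level 40, left associativity).
Local Notation star := (gstar inv).
Local Notation Z := [set phi | spherical_pd mul inv e J phi].

Variable toC : {rmorphism R -> C}.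
Hypotheses (hC : real_embedding toC) (hS : gelfand_setting mul inv e I K J).

Let hG : haar_setting mul inv e I. Proof. by case: hS. Qed.
Let mI : mean I. Proof. by case: hG => _ []. Qed.
Let gG : is_group mul inv e. Proof. by case: hG => -[]. Qed.
Let cG : compact [set: G]. Proof. by case: hG => -[]. Qed.

Lemma spherical_projection phi : Z phi ->
  let p x := (ip I phi phi)^-1 * phi x in
  [/\ contf p, star p = p, p ** p = p &
    forall g, contf g -> ip I g p = ip I g phi / ip I phi phi].
Proof.
move=> Zphi p; have cphi := spherical_cont Zphi.
have c0 := spherical_ip_gt0 hS Zphi.
have cr : ((ip I phi phi)^-1)^* = (ip I phi phi)^-1.
  by apply: ge0_conjC; rewrite invr_ge0 ltW.
have cp : contf p by rewrite /p; cont.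
split => //.
- by apply: star_eqZ => //; exact: (spherical_star hS Zphi).
- rewrite (gconvZl hG)// (gconvZr hG)// (spherical_idem hS Zphi).
  by apply/funext => x; rewrite mulKf// gt_eqF.
- move=> g cg; rewrite /p mulrC /ip -/(ip I phi phi) -meanZ//; last by cont.
  by congr I; apply/funext => x; rewrite conjE cr mulrCA.
Qed.

Variables (L : topologicalType) (mulL : L -> L -> L) (invL : L -> L) (eL : L).
Hypothesis gL : is_group mulL invL eL.
Let mulP (a b : G * L) := (mul a.1 b.1, mulL a.2 b.2).
Let invP (a : G * L) := (inv a.1, invL a.2).
Variable f : G * L -> C.

Section Converse.
Variable B : (G -> C) -> L -> C.
Hypotheses (pB : forall phi, Z phi -> posdef mulL invL (B phi))
  (tB : small_tails Z (fun phi => B phi eL))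
  (fB : forall p (d : C), 0 < d -> exists F0 : set (G -> C), [/\ finite_set F0, F0 `<=` Z &
    forall A, finite_set A -> F0 `<=` A -> A `<=` Z ->
      `|f p - \sum_(phi \in A) B phi p.2 * phi p.1| <= d]).

(** [|B phi u| <= B phi eL] and [|phi| <= 1] give a majorant independent of the point. *)
Lemma expansion_unif : unif_sum Z (fun phi (p : G * L) => B phi p.2 * phi p.1) f.
Proof.
apply: (small_tails_unif (b := fun phi => B phi eL)) => // phi p Zphi.
rewrite normrM -[leRHS]mulr1 ler_pM//; last exact: (spherical_norm_le hS).
exact: (posdef_norm_le gL (pB Zphi)).
Qed.

Lemma expansion_coeff u phi : contf f -> Z phi ->
  B phi u = ip I (fun x => f (x, u)) phi / ip I phi phi.
Proof.
move=> cf Zphi; have c0 := spherical_ip_gt0 hS Zphi.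
rewrite (unif_sum_coeff (b := fun phi => B phi u) hS _ _ Zphi) ?mulfK ?gt_eqF//.
  exact: contf_slicel.
move=> d /expansion_unif[F0 [fF FZ hF]]; exists F0; split => // A fA FA AZ x.
exact: (hF A fA FA AZ (x, u)).
Qed.

Lemma expansion_posdef : posdef mulP invP f.
Proof.
move=> n xs c.
apply: (@ge0_of_close _ _ (\sum_(j < n) \sum_(k < n) `|c j| * `|c k|)) => d d0.
have [F0 [fF FZ hF]] := expansion_unif d0.
pose S p := \sum_(phi \in F0) B phi p.2 * phi p.1.
have pS : posdef mulP invP S.
  rewrite (_ : S = fun p => \sum_(phi <- finmap.enum_fset (fset_set F0)) B phi p.2 * phi p.1).
    apply: posdef_sum => phi; rewrite in_fset_set// inE => /FZ Zphi.
    by apply: (spherical_posdefM hS) => //; exact: pB.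
  by apply/funext => p; rewrite /S fsbig_finite.
exists (\sum_(j < n) \sum_(k < n) S (mulP (invP (xs j)) (xs k)) * c j * (c k)^*).
  exact: pS.
rewrite -sumrB mulr_suml; apply: le_trans (ler_norm_sum _ _ _) _; apply: ler_sum => j _.
rewrite -sumrB mulr_suml; apply: le_trans (ler_norm_sum _ _ _) _; apply: ler_sum => k _.
rewrite -!mulrBl !normrM norm_conjC -mulrA mulrC ler_wpM2l ?mulr_ge0//.
exact: (hF F0 fF (@subset_refl _ _) FZ).
Qed.

Lemma expansion_biK u k l x : K k -> K l -> f (mul (mul k x) l, u) = f (x, u).
Proof.
move=> Kk Kl; apply: (@eq_of_close _ _ _ 2) => d d0.
have [F0 [fF FZ hF]] := expansion_unif d0.
have h1 := hF F0 fF (@subset_refl _ _) FZ (mul (mul k x) l, u).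
have h2 := hF F0 fF (@subset_refl _ _) FZ (x, u).
have E : \sum_(phi \in F0) B phi u * phi (mul (mul k x) l) = \sum_(phi \in F0) B phi u * phi x.
  apply: eq_fsbigr => phi; rewrite inE => /FZ Zphi.
  by have [fl fr] := spherical_biK hS Zphi; rewrite (fr _ _ Kl) (fl _ _ Kk).
rewrite /= E in h1; rewrite -(subrKA (\sum_(phi \in F0) B phi u * phi x)).
by rewrite (le_trans (ler_normD _ _))// mulr_natl mulr2n lerD// distrC.
Qed.

End Converse.

Section Direct.
Hypotheses (cf : contf f) (pf : posdef mulP invP f)
  (Kf : forall k l x u, K k -> K l -> f (mul (mul k x) l, u) = f (x, u)).
Let B phi u := ip I (fun x => f (x, u)) phi / ip I phi phi.

Let cfu u : contf (fun x => f (x, u)). Proof. exact: contf_slicel. Qed.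
Arguments cfu : clear implicits.

Lemma coeff_cont phi : Z phi -> contf (B phi).
Proof.
move=> Zphi; have cphi := spherical_cont Zphi.
apply: contfM; last exact: contf_cst.
have cH : contf (fun a : G * L => f a * (phi a.1)^*).
  have c1 : contf (fun a : G * L => phi a.1).
    by apply: (contf_comp _ cphi) => a; exact: cvg_fst.
  by cont.
exact: (mean_contl mI cG cH).
Qed.

Lemma coeff_pd phi : Z phi -> posdef mulL invL (B phi).
Proof.
move=> Zphi; have [cp sp pp ipp] := spherical_projection Zphi.
have := coeff_posdef hS cfu pf cp sp pp.
by congr (posdef _ _ _); apply/funext => u; rewrite /B ipp.
Qed.

(** On the slice [u = eL], [f] is positive definite on [G]. *)
Lemma coeff_sum_bound A : finite_set A -> A `<=` Z ->
  \sum_(phi \in A) B phi eL <= f (e, eL).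
Proof.
move=> fA AZ; apply: (coeff_sum_le hS (F := fun x => f (x, eL))) => //.
move=> n xs c; have := pf (fun j => (xs j, eL)) c.
congr (0 <= _); apply: eq_bigr => j _; apply: eq_bigr => k _.
by case: gL => _ _ _ h _; rewrite /mulP /invP /= h.
Qed.

Lemma coeff_expansion u : small_tails Z (fun phi => B phi eL) ->
  unif_sum Z (fun phi x => B phi u * phi x) (fun x => f (x, u)).
Proof.
move=> tB; have [Ke _ _] : is_subgroup mul inv e K by case: hS.
have [_ l r _ _] := gG.
apply: (spherical_expansion hC hS (h := fun x => f (x, u)) _ _ _ tB) => //.
  by split=> k x Kk; [rewrite -[RHS](Kf x u Kk Ke) r|rewrite -[RHS](Kf x u Ke Kk) l].
by move=> phi Zphi; exact: (posdef_norm_le gL (coeff_pd Zphi)).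
Qed.

End Direct.
End ProductExpansion.

(** * Specialization to R[i] *)

Lemma real_embedding_complex (R : realType) :
  @real_embedding R R[i] (real_complex R).
Proof.
split=> [x y|z zr]; first exact: lecR.
by exists (complex.Re z); exact/esym/RRe_real.
Qed.

(** Urysohn's lemma for [y] and the complement of the interior of [U]. *)
Lemma bumps_complex (R : realType) (T : topologicalType) :
  hausdorff_space T -> compact [set: T] -> bumps R[i] T.
Proof.
move=> hT cT y U nU.
have hC := real_embedding_complex R.
have nT := compact_normal hT cT.
have sep : uniform_separator [set y] (~` U^°).
  apply: (normal_uniform_separator nT).
  - exact/accessible_closed_set1/hausdorff_accessible.
  - exact/open_closedC/open_interior.
  - by apply/seteqP; split => // x [-> ]; apply; exact: nU.
have [f [cf f01 f0 f1]] := proj1 (@uniform_separatorP T R _ _) sep.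
exists (fun x => real_complex R (1 - f x)); split.
- apply/contfP => x e /(toC_gt0P hC)[r r0 ->].
  have /cvgrPdist_lt/(_ r r0) := cf x; apply: filterS => z h.
  rewrite -rmorphB (toC_norm hC) (toC_lt hC).
  by rewrite opprB addrC addrA subrK distrC.
- move=> x; rewrite (toC_ge0 hC) subr_ge0.
  have /f01 : range f (f x) by exists x.
  by rewrite /= in_itv /= => /andP[].
- by rewrite (f0 (f y)) ?subr0 ?rmorph1//; exists y.
- move=> x; apply: contra_neqP => nUx.
  rewrite (f1 (f x)) ?subrr ?rmorph0//; exists x => // hx; apply: nUx.
  exact: interior_subset hx.
Qed.

Section Instance.
Variables (R : realType) (G : topologicalType).
Variables (mul : G -> G -> G) (inv : G -> G) (e : G) (K : set G) (IG IK : (G -> R[i]) -> R[i]).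
Hypotheses (hG : is_compact_group mul inv e) (hK : is_subgroup mul inv e K)
  (hIG : is_haar_integral mul [set: G] IG) (hIK : is_haar_integral mul K IK)
  (hgel : is_gelfand mul inv IG K).

Lemma gelfand_setting_complex : gelfand_setting mul inv e IG K IK.
Proof.
case: hG => -[gG cm ci] hT cT; case: hIG => -[aG zG pG sG oG] iG.
case: hIK => -[aK zK pK sK oK] iK.
have mG : mean IG.
  by split; [exact: aG|exact: zG|move=> f cf f0; exact: (pG f cf (fun x _ => f0 x))|exact: oG].
have mK : mean IK.
  by split; [exact: aK|exact: zK|move=> f cf f0; exact: (pK f cf (fun x _ => f0 x))|exact: oK].
have bG : bumps R[i] G by exact: bumps_complex hT cT.
split; [split|exact: hK|split; [exact: mK|exact: iK]|exact: sK|].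
- by split; [exact: gG|exact: cm|exact: ci|exact: cT|exact: bG].
- by split; [exact: mG|move=> h f cf; exact: (iG h f I cf)].
- move=> f g cf cg [fl fr] [gl gr]; apply: (hgel cf cg).
    by move=> k l x Kk Kl; rewrite fr ?fl.
  by move=> k l x Kk Kl; rewrite gr ?gl.
Qed.

Lemma Zset_spherical phi : Zset mul inv e IK phi <-> spherical_pd mul inv e IK phi.
Proof. by split=> [[[c1 h1 h2] [_ h3]]|[c1 h1 h2 h3]]; split. Qed.

Lemma delta_ip phi : Zset mul inv e IK phi -> (delta mul inv phi)%:R = (ip IG phi phi)^-1.
Proof.
move=> /Zset_spherical sphi.
have hS := gelfand_setting_complex.
have [n hn] := translates_dim_exists (real_embedding_complex R) hS sphi.
(* A dimension exists, so [delta] is not the default value 0 of [xget]. *)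
have [h1 h2] : translate_span_dim mul inv phi (delta mul inv phi).
  exact: (@xgetPex _ 0%N [set n | translate_span_dim mul inv phi n] (ex_intro _ n hn)).
have := translates_dim_eq hS sphi h1 h2.
have n0 := lt0r_neq0 (spherical_ip_gt0 hS sphi).
by move=> h; apply: (mulIf n0); rewrite h mulVf.
Qed.

End Instance.

Section ComplexSums.
Variables (R : realType) (T : choiceType) (Z : set T).

(** Exchanges strict bounds by real errors for large bounds by errors in [C]; halving the error
    restores strictness. *)
Lemma sum_pointwiseP (P : Type) (a : T -> P -> R[i]) (F : P -> R[i]) :
  sum_pointwise Z a F <-> forall p (d : R[i]), 0 < d -> exists F0 : set T,
    [/\ finite_set F0, F0 `<=` Z & forall A, finite_set A -> F0 `<=` A -> A `<=` Z ->
      `|F p - \sum_(i \in A) a i p| <= d].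
Proof.
have hC := real_embedding_complex R.
split=> h p.
  move=> d /(toC_gt0P hC)[r r0 ->]; have [F0 [fF FZ hF]] := h p r r0.
  by exists F0; split => // A fA FA AZ; apply: ltW; exact: hF.
move=> r r0; have d0 : 0 < real_complex R (r / 2) by rewrite (toC_gt0 hC) divr_gt0.
have [F0 [fF FZ hF]] := h p _ d0; exists F0; split => // A fA FA AZ.
apply: le_lt_trans (hF A fA FA AZ) _; rewrite (toC_lt hC).
by rewrite ltr_pdivrMr// mulr_natr mulr2n ltrDl.
Qed.

Lemma unif_sum_uniform (P : Type) (a : T -> P -> R[i]) (F : P -> R[i]) :
  unif_sum Z a F -> sum_uniform Z a F.
Proof.
have hC := real_embedding_complex R.
move=> h r r0; have d0 : 0 < real_complex R (r / 2) by rewrite (toC_gt0 hC) divr_gt0.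
have [F0 [fF FZ hF]] := h _ d0; exists F0; split => // A fA FA AZ p.
apply: le_lt_trans (hF A fA FA AZ p) _; rewrite (toC_lt hC).
by rewrite ltr_pdivrMr// mulr_natr mulr2n ltrDl.
Qed.

Variable b : T -> R[i].
Hypothesis b0 : forall i, Z i -> 0 <= b i.

Lemma fsum_Re (A : set T) : finite_set A -> A `<=` Z ->
  \sum_(i \in A) b i = real_complex R (\sum_(i \in A) complex.Re (b i)).
Proof.
move=> fA AZ; rewrite !fsbig_finite//= rmorph_sum /=; apply: eq_big_seq => i.
rewrite in_fset_set// inE => /AZ/b0/ger0_real h.
exact/esym/RRe_real.
Qed.

Lemma Re_ge0 (z : R[i]) : 0 <= z -> 0 <= complex.Re z.
Proof. by case: z => x y; rewrite lecE /= => /andP[]. Qed.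

Lemma small_tails_esum : (\esum_(i in Z) (complex.Re (b i))%:E < +oo)%E -> small_tails Z b.
Proof.
have hC := real_embedding_complex R.
move=> boo d /(toC_gt0P hC)[r r0 ->].
have [|F0 [fF FZ hF]] := esum_small_tail _ boo r0; first by move=> i /b0/Re_ge0.
exists F0; split => // A fA AZ AF.
by rewrite fsum_Re// (toC_le hC); exact: hF.
Qed.

Lemma esum_fsum_ltoo (M : R[i]) :
  (forall A, finite_set A -> A `<=` Z -> \sum_(i \in A) b i <= M) ->
  (\esum_(i in Z) (complex.Re (b i))%:E < +oo)%E.
Proof.
have hC := real_embedding_complex R.
move=> hM; have M0 : 0 <= M.
  by have := hM set0 (finite_set0 _) (@sub0set _ _); rewrite fsbig_set0.
have [m m0 Mm] := toC_ge0P hC M0.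
apply: (@esum_ltoo _ _ _ _ m) => A fA AZ.
by have := hM A fA AZ; rewrite fsum_Re// Mm (toC_le hC).
Qed.

End ComplexSums.

Theorem theorem3p3 (R : realType)
  (G : topologicalType) (mulG : G -> G -> G) (invG : G -> G) (eG : G)
  (K : set G) (IG IK : (G -> R[i]) -> R[i])
  (L : topologicalType) (mulL : L -> L -> L) (invL : L -> L) (eL : L)
  (f : G * L -> R[i]) :
  is_compact_group mulG invG eG ->
  is_subgroup mulG invG eG K -> compact K ->
  is_haar_integral mulG [set: G] IG ->
  is_haar_integral mulG K IK ->
  is_gelfand mulG invG IG K ->
  is_lc_group mulL invL eL ->
  contC f ->
  (Psharp mulG invG K mulL invL f <->
    exists B : (G -> R[i]) -> L -> R[i],
      [/\ forall phi, Zset mulG invG eG IK phi -> PD mulL invL (B phi),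
          (\esum_(phi in Zset mulG invG eG IK) (complex.Re (B phi eL))%:E < +oo)%E &
          sum_pointwise (Zset mulG invG eG IK)
            (fun phi p => B phi p.2 * phi p.1) f])
  /\
  (forall B : (G -> R[i]) -> L -> R[i],
      (forall phi, Zset mulG invG eG IK phi -> PD mulL invL (B phi)) ->
      (\esum_(phi in Zset mulG invG eG IK) (complex.Re (B phi eL))%:E < +oo)%E ->
      sum_pointwise (Zset mulG invG eG IK) (fun phi p => B phi p.2 * phi p.1) f ->
      sum_uniform (Zset mulG invG eG IK) (fun phi p => B phi p.2 * phi p.1) f /\
      (forall phi, Zset mulG invG eG IK phi -> forall u,
         B phi u = (delta mulG invG phi)%:R *
                   IG (fun x => f (x, u) * (phi x)^*))).
Proof.
move=> hG hK _ hIG hIK hgel hL cf.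
have hC := real_embedding_complex R.
have hS := gelfand_setting_complex hG hK hIG hIK hgel.
have gL : is_group mulL invL eL by case: hL => -[].
have dE phi (Zphi : Zset mulG invG eG IK phi) := delta_ip hG hK hIG hIK hgel Zphi.
have ZE : Zset mulG invG eG IK = [set phi | spherical_pd mulG invG eG IK phi].
  by apply/seteqP; split=> phi /Zset_spherical.
rewrite ZE in dE *.
have tails (B : (G -> R[i]) -> L -> R[i]) :
    (forall phi, spherical_pd mulG invG eG IK phi -> PD mulL invL (B phi)) ->
    (\esum_(phi in [set phi | spherical_pd mulG invG eG IK phi])
       (complex.Re (B phi eL))%:E < +oo)%E ->
    small_tails [set phi | spherical_pd mulG invG eG IK phi] (fun phi => B phi eL).
  move=> pB; apply: small_tails_esum => phi /pB[_ pd].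
  exact: (posdef_e_ge0 gL pd).
split; last first.
  move=> B pB boo /sum_pointwiseP fB; have tB := tails B pB boo.
  have pB' phi (Zphi : spherical_pd mulG invG eG IK phi) := proj2 (pB phi Zphi).
  split; first exact: (unif_sum_uniform (expansion_unif hS gL pB' tB fB)).
  move=> phi Zphi u; rewrite dE// mulrC.
  exact: (expansion_coeff hS gL pB' tB fB u cf Zphi).
split=> [[_ pf Kf]|[B [pB boo /sum_pointwiseP fB]]]; last first.
  have tB := tails B pB boo.
  have pB' phi (Zphi : spherical_pd mulG invG eG IK phi) := proj2 (pB phi Zphi).
  split => //; first exact: (expansion_posdef hS gL pB' tB fB).
  by move=> k l x u; exact: (expansion_biK hS gL pB' tB fB).
(* By [delta_ip] the factor [1 / |phi|^2] is [delta phi], so these are the coefficients of the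
   statement. *)
pose B phi u := ip IG (fun x => f (x, u)) phi / ip IG phi phi.
have pB phi : spherical_pd mulG invG eG IK phi -> PD mulL invL (B phi).
  move=> Zphi; split; first exact: (coeff_cont hS cf Zphi).
  exact: (coeff_pd hS cf pf Zphi).
have boo : (\esum_(phi in [set phi | spherical_pd mulG invG eG IK phi])
       (complex.Re (B phi eL))%:E < +oo)%E.
  apply: (@esum_fsum_ltoo _ _ _ _ _ (f (eG, eL))).
    by move=> phi /pB[_ pd]; exact: (posdef_e_ge0 gL pd).
  by move=> A; exact: (coeff_sum_bound hS gL cf pf).
exists B; split => //; apply/sum_pointwiseP => -[x u] d d0.
have [F0 [fF FZ hF]] := coeff_expansion hC hS gL cf pf Kf u (tails B pB boo) d0.
by exists F0; split => // A fA FA AZ; exact: hF.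
Qed.
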